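(* Let $\alpha_0,\alpha_1\in(0,\infty)$, $p\in[1,\infty)$, and for $u=(u_{i,j})_{1\le i\le N_1,1\le j\le N_2}$ in $\mathcal M$ let $$\begin{aligned}\text{PT-TGV}^2_\alpha(u)=\min_{y^1_{i,j},y^2_{i,j}\in\mathcal M}\ &\alpha_1\sum_{i,j}\Big(d(u_{i+1,j},y^1_{i,j})^p+d(u_{i,j+1},y^2_{i,j})^p\Big)^{1/p}\\&+\alpha_0\sum_{i,j}\Big(\mathrm D_{\mathrm{pt}}([u_{i,j},y^1_{i,j}],[u_{i-1,j},y^1_{i-1,j}])^p+\mathrm D_{\mathrm{pt}}([u_{i,j},y^2_{i,j}],[u_{i,j-1},y^2_{i,j-1}])^p\\&\qquad+2^{1-p}\,\mathrm D_{\mathrm{pt}}^{\mathrm{sym}}([u_{i,j},y^1_{i,j}],[u_{i,j},y^2_{i,j}],[u_{i,j-1},y^1_{i,j-1}],[u_{i-1,j},y^2_{i-1,j}])^p\Big)^{1/p}.\qquad( * )\end{aligned}$$ Then the following hold. (M-P1') If $\mathcal M=\mathbb R^K$ (Euclidean), then $\text{PT-TGV}^2_\alpha$ coincides with the discrete vector-space functional $$\begin{aligned}\mathrm{TGV}^2_\alpha(u)=\min_{w^1,w^2}&\sum_{i,j}\alpha_1\Big(|u_{i+1,j}-u_{i,j}-w^1_{i,j}|^p+|u_{i,j+1}-u_{i,j}-w^2_{i,j}|^p\Big)^{1/p}\\&+\alpha_0\sum_{i,j}\Big(|w^1_{i-1,j}-w^1_{i,j}|^p+|w^2_{i,j-1}-w^2_{i,j}|^p+2^{1-p}|(w^1_{i,j-1}-w^1_{i,j})+(w^2_{i-1,j}-w^2_{i,j})|^p\Big)^{1/p}.\end{aligned}$$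 (M-P2') If the minimum in $( * )$ is attained at $y^1_{i,j}=y^2_{i,j}=u_{i,j}$ for all $i,j$, then $\text{PT-TGV}^2_\alpha(u)=\alpha_1\sum_{i,j}\big(d(u_{i+1,j},u_{i,j})^p+d(u_{i,j+1},u_{i,j})^p\big)^{1/p}$. (M-P3') There is an admissible generalization $\mathrm{TV}^2$ such that, whenever the minimum in $( * )$ is attained at $y^1_{i,j}=u_{i+1,j}$ and $y^2_{i,j}=u_{i,j+1}$ for all $i,j$, $\text{PT-TGV}^2_\alpha(u)=\alpha_0\mathrm{TV}^2(u)$. Moreover, if $u$ is locally geodesic, then $\text{PT-TGV}^2_\alpha(u)=0$. If $u$ is such that the length-minimizing geodesic connecting each pair $u_{i,j}$ and $u_{i',j'}$ with $\max\{|i-i'|,|j-j'|\}\le 2$ is unique and $\text{PT-TGV}^2_\alpha(u)=0$, then $u$ is geodesic.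
   Context: $\mathcal M\subset\mathbb R^K$ is a complete (connected, finite-dimensional) Riemannian manifold with Levi-Civita connection and Riemannian distance $d$; $|\cdot|_x$ is the norm on $T_x\mathcal M$. Geodesics extend to all of $\mathbb R$, and any two points are joined by a length-minimizing geodesic. For $a,b\in\mathcal M$: $\log_a(b)=\{z\in T_a\mathcal M\mid\exp_a(z)=b$ and $[0,1]\ni t\mapsto\exp_a(tz)$ is a length-minimizing geodesic$\}$. For $w\in T_a\mathcal M$, $\mathrm{pt}_b(w)\subset T_b\mathcal M$ is the set of all vectors obtained by parallel transport of $w$ from $a$ to $b$ along some length-minimizing geodesic connecting $a$ and $b$. One-element sets are identified with their element. A pair $[x,y]$ denotes an element of $\mathcal M^2$. For $x,y,u,v\in\mathcal M$, $\mathrm D_{\mathrm{pt}}([x,y],[u,v])=\min|z_1-z_2|_x$ over $z_1\in\log_x(y)$, $z_2\in T_x\mathcal M$ subject to $z_2\in\mathrm{pt}_x(w)$ for some $w\in\log_u(v)$. Further, $$\mathrm D_{\mathrm{pt}}^{\mathrm{sym}}([a,b],[\tilde a,\tilde b],[e,f],[g,h])=\min_{r^1,r^2}\mathrm D_{\mathrm{pt}}([r^1,h],[f,r^2])$$ subject to $r^1\in\exp_g(\mathrm{pt}_g(w^1))$ with $w^1\in\log_a(b)$ and $r^2\in\exp_e(\mathrm{pt}_e(w^2))$ with $w^2\in\log_{\tilde a}(\tilde b)$. Index convention: $y^1_{i,j},w^1_{i,j}$ are indexed by $1\le i\le N_1-1$, $1\le j\le N_2$, and $y^2_{i,j},w^2_{i,j}$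 by $1\le i\le N_1$, $1\le j\le N_2-1$. In all sums every single term (distance, $\mathrm D_{\mathrm{pt}}$, $\mathrm D_{\mathrm{pt}}^{\mathrm{sym}}$ or norm) involving an out-of-range index is set to zero. An admissible generalization of $\mathrm{TV}^2$ is any functional on signals $(u_{i,j})_{i,j}$ in $\mathcal M$ that in case $\mathcal M=\mathbb R^K$ equals $\sum_{i,j}\big(|u_{i+1,j}-2u_{i,j}+u_{i-1,j}|^p+|u_{i,j+1}-2u_{i,j}+u_{i,j-1}|^p+2^{1-p}|(u_{i+1,j}-u_{i,j})-(u_{i+1,j-1}-u_{i,j-1})+(u_{i,j+1}-u_{i,j})-(u_{i-1,j+1}-u_{i-1,j})|^p\big)^{1/p}$ (same convention). A finite sequence $(v_i)_{i=0}^n$ in $\mathcal M$ is geodesic if there is a unit speed geodesic $\gamma:[0,L]\to\mathcal M$ (constant sequences correspond to $L=0$) with $\gamma(iL/n)=v_i$ for all $i$ and $d(v_i,v_{i+1})=L/n$ for $i=0,\dots,n-1$; it is locally geodesic if $(v_j)_{j=i-1}^{i+1}$ is geodesic for each $i\in\{1,\dots,n-1\}$. A signal $u=(u_{i,j})_{i,j}$ is (locally) geodesic if for each $(i_0,j_0)$ the univariate signals $(u_{i,j_0})_i$, $(u_{i_0,j})_j$ and $(u_{i_0+k,j_0-k})_k$ (over all admissible indices) are (locally) geodesic. *)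

(* Defs.v *)
From mathcomp Require Import all_boot all_order all_algebra.
From mathcomp Require Import all_classical all_reals all_analysis.

Set Implicit Arguments.
Unset Strict Implicit.
Unset Printing Implicit Defensive.

Import Order.TTheory GRing.Theory Num.Theory.
Import numFieldNormedType.Exports.

Local Open Scope classical_set_scope.
Local Open Scope ring_scope.

(* A minimum is represented by the set of its values: [set m] when it is
   attained with value m, and set0 when it is not attained. *)
Definition minimum (R : realType) (S : set R) : set R :=
  [set m | S m /\ lbound S m].

Definition dotp (R : realType) (K : nat) (v w : 'rV[R]_K) : R :=
  (v *m w^T) 0 0.

(* The norm of the library on row vectors is the sup norm; it is used only for
   topology and derivatives. *)
Definition enorm (R : realType) (K : nat) (v : 'rV[R]_K) : R :=
  Num.sqrt (dotp v v).

Section Smooth.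
Variables (R : realType) (V W : normedModType R).

Fixpoint Ck (n : nat) (U : set V) (f : V -> W) : Prop :=
  match n with
  | 0 => forall x, U x -> {for x, continuous f}
  | n'.+1 => (forall x, U x -> differentiable f x) /\
             (forall v, Ck n' U (fun x => derive f x v))
  end.

Definition smooth (U : set V) (f : V -> W) : Prop := forall n, Ck n U f.

End Smooth.

Section Embedded.
Variables (R : realType) (K : nat).
Local Notation vec := 'rV[R]_K.
Implicit Types (M : set vec) (x v w : vec).

(* [M] is an embedded smooth submanifold of dimension [m]: near each of its
   points it is parametrized by a smooth map [phi] on an open set of R^m whose
   inverse is the restriction to [M] of a smooth map [psi]. *)
Definition submanifold (m : nat) M : Prop :=
  forall x, M x ->
  exists (U : set 'rV[R]_m) (W : set vec)
         (phi : 'rV[R]_m -> vec) (psi : vec -> 'rV[R]_m),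
    [/\ open U, open W, W x, smooth U phi & smooth W psi] /\
    [/\ forall a, U a -> M (phi a) /\ W (phi a),
        forall a, U a -> psi (phi a) = a
      & forall y, M y -> W y -> U (psi y) /\ phi (psi y) = y].

Definition tangent M x v : Prop :=
  exists c : R -> vec,
    [/\ \forall t \near (0 : R), M (c t), c 0 = x & is_derive (0 : R) 1 c v].

(* Smooth fields of bilinear forms on the tangent spaces; smoothness on [M] is
   local extendability to a smooth function on an open set of R^K. *)
Definition smooth_form M (b : vec -> vec -> vec -> R) : Prop :=
  forall x, M x ->
  exists (W : set vec) (G : vec -> 'M[R]_K),
    [/\ open W, W x, smooth W G
      & forall y v w, M y -> W y -> tangent M y v -> tangent M y w ->
          b y v w = (v *m G y *m w^T) 0 0].

Definition riemannian_metric M (g : vec -> vec -> vec -> R) : Prop :=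
  [/\ smooth_form M g,
      forall x v w, M x -> tangent M x v -> tangent M x w -> g x v w = g x w v
    & forall x v, M x -> tangent M x v -> v != 0 -> 0 < g x v v].

Definition curve_in M (c : R -> vec) : Prop :=
  forall t, M (c t) /\ derivable c t 1.

Definition field_along M (c V : R -> vec) : Prop :=
  forall t, tangent M (c t) (V t) /\ derivable V t 1.

(* An affine connection on [M] differs from the directional derivative of R^K
   by a tensor field: nabla_v Y = D_v Y + C_x(v, Y(x)) for v in T_x M. It is
   represented by [C], which is arbitrary except that the right-hand side is
   tangent. The induced covariant derivative of V along c is then: *)
Definition covd (C : vec -> vec -> vec -> vec) (c V : R -> vec) (t : R) : vec :=
  derive1 V t + C (c t) (derive1 c t) (V t).

Definition affine_connection M (C : vec -> vec -> vec -> vec) : Prop :=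
  (forall k : 'I_K, smooth_form M (fun x v w => C x v w 0 k)) /\
  (forall c V t, curve_in M c -> field_along M c V ->
     tangent M (c t) (covd C c V t)).

(* Since [X, Y] = D_X Y - D_Y X, the torsion of the connection is
   C(X, Y) - C(Y, X). *)
Definition torsion_free M (C : vec -> vec -> vec -> vec) : Prop :=
  forall x v w, M x -> tangent M x v -> tangent M x w -> C x v w = C x w v.

Definition metric_compatible M (g : vec -> vec -> vec -> R)
    (C : vec -> vec -> vec -> vec) : Prop :=
  forall c V W t, curve_in M c -> field_along M c V -> field_along M c W ->
    is_derive t (1 : R) (fun s => g (c s) (V s) (W s))
      (g (c t) (covd C c V t) (W t) + g (c t) (V t) (covd C c W t)).

Definition levi_civita M (g : vec -> vec -> vec -> R)
    (C : vec -> vec -> vec -> vec) : Prop :=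
  [/\ affine_connection M C, torsion_free M C & metric_compatible M g C].

Definition curve_length (g : vec -> vec -> vec -> R) (c : R -> vec) (a b : R) :
    R :=
  \int[lebesgue_measure]_(t in `[a, b])
     Num.sqrt (g (c t) (derive1 c t) (derive1 c t)).

(* Any piecewise C^1 curve in [M] on [0, 1] has a reparametrization, of the
   same length, that is C^1 on R: stop at the break points and outside of
   [0, 1]. *)
Definition distance M (g : vec -> vec -> vec -> R) (x y : vec) : R :=
  inf [set l | exists c : R -> vec,
    [/\ curve_in M c, continuous (derive1 c), c 0 = x, c 1 = y
      & l = curve_length g c 0 1]].

(* Geodesics are parametrized by R; on a complete manifold, geodesics on
   intervals are restrictions of these. *)
Definition geodesic_curve M (C : vec -> vec -> vec -> vec) (c : R -> vec) :
    Prop :=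
  curve_in M c /\
  forall t, derivable (derive1 c) t 1 /\ covd C c (derive1 c) t = 0.

Definition minimizing_geodesic M g C (c : R -> vec) (x y : vec) : Prop :=
  [/\ geodesic_curve M C c, c 0 = x, c 1 = y
    & curve_length g c 0 1 = distance M g x y].

End Embedded.

(* The last two fields hold on every connected manifold satisfying the previous
   ones (Hopf-Rinow). *)
Record complete_manifold (R : realType) (K : nat) := CompleteManifold {
  carrier : set 'rV[R]_K;
  mdim : nat;
  metric : 'rV[R]_K -> 'rV[R]_K -> 'rV[R]_K -> R;
  conn : 'rV[R]_K -> 'rV[R]_K -> 'rV[R]_K -> 'rV[R]_K;
  carrier_connected : connected carrier;
  carrier_submanifold : submanifold mdim carrier;
  metric_riemannian : riemannian_metric carrier metric;
  conn_levi_civita : levi_civita carrier metric conn;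
  distance_complete : forall x : nat -> 'rV[R]_K,
    (forall n, carrier (x n)) ->
    (forall e : R, 0 < e -> exists N, forall m n, (N <= m)%N -> (N <= n)%N ->
       distance carrier metric (x m) (x n) < e) ->
    exists2 l, carrier l &
      forall e : R, 0 < e -> exists N, forall n, (N <= n)%N ->
        distance carrier metric (x n) l < e;
  geodesics_extend : forall x v, carrier x -> tangent carrier x v ->
    exists c, [/\ geodesic_curve carrier conn c, c 0 = x & derive1 c 0 = v];
  minimizing_geodesic_exists : forall x y, carrier x -> carrier y ->
    exists c, minimizing_geodesic carrier metric conn c x y
}.

Section Manifold.
Variables (R : realType) (K : nat) (M : complete_manifold R K).
Local Notation vec := 'rV[R]_K.

Definition euclidean : Prop :=
  carrier M = setT /\ forall x v w, metric M x v w = dotp v w.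

Definition rdist (x y : vec) : R := distance (carrier M) (metric M) x y.

Definition tnorm (x v : vec) : R := Num.sqrt (metric M x v v).

Definition geodesic (c : R -> vec) : Prop :=
  geodesic_curve (carrier M) (conn M) c.

Definition min_geodesic (c : R -> vec) (x y : vec) : Prop :=
  minimizing_geodesic (carrier M) (metric M) (conn M) c x y.

Definition expm (a z : vec) : set vec :=
  [set b | exists c, [/\ geodesic c, c 0 = a, derive1 c 0 = z & b = c 1]].

(* The geodesic [c] starting at a with velocity z is t |-> exp_a (t z). *)
Definition logm (a b : vec) : set vec :=
  [set z | exists c, min_geodesic c a b /\ derive1 c 0 = z].

Definition parallel (c V : R -> vec) : Prop :=
  field_along (carrier M) c V /\ forall t, covd (conn M) c V t = 0.

(* [ptm a b w] is pt_b(w) for w in T_a M. *)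
Definition ptm (a b w : vec) : set vec :=
  [set z | exists c V, [/\ min_geodesic c a b, parallel c V, V 0 = w & z = V 1]].

(* D_pt([x, y], [u, v]) *)
Definition Dpt (x y u v : vec) : set R :=
  minimum [set r | exists z1 z2 w,
    [/\ logm x y z1, logm u v w, ptm u x w z2 & r = tnorm x (z1 - z2)]].

(* D_pt^sym([a, b], [a', b'], [e, f], [g, h]) *)
Definition Dptsym (a b a' b' e f g h : vec) : set R :=
  minimum [set r | exists r1 r2,
    [/\ exists w1 z1, [/\ logm a b w1, ptm a g w1 z1 & expm g z1 r1],
        exists w2 z2, [/\ logm a' b' w2, ptm a' e w2 z2 & expm e z2 r2]
      & Dpt r1 h f r2 r]].

End Manifold.

(* Signals and the auxiliary y^1, y^2 are functions of two natural numbers; only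
   their values in the following ranges matter. *)
Definition in_u (N1 N2 i j : nat) : bool :=
  (1 <= i <= N1)%N && (1 <= j <= N2)%N.
Definition in_1 (N1 N2 i j : nat) : bool :=
  (1 <= i < N1)%N && (1 <= j <= N2)%N.
Definition in_2 (N1 N2 i j : nat) : bool :=
  (1 <= i <= N1)%N && (1 <= j < N2)%N.

(* The ranges of the terms D_pt([u_ij, y^1_ij], [u_(i-1)j, y^1_(i-1)j]) and
   D_pt([u_ij, y^2_ij], [u_i(j-1), y^2_i(j-1)]), and of the D_pt^sym term.
   Recall 0.-1 = 0, which is out of range. *)
Definition in_D1 (N1 N2 i j : nat) : bool := in_1 N1 N2 i j && in_1 N1 N2 i.-1 j.
Definition in_D2 (N1 N2 i j : nat) : bool := in_2 N1 N2 i j && in_2 N1 N2 i j.-1.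
Definition in_D3 (N1 N2 i j : nat) : bool :=
  [&& in_1 N1 N2 i j, in_2 N1 N2 i j, in_1 N1 N2 i j.-1 & in_2 N1 N2 i.-1 j].

Section Costs.
Variables (R : realType) (p : R) (N1 N2 : nat).

Definition grid_sum (F : nat -> nat -> R) : R :=
  \sum_(1 <= i < N1.+1) \sum_(1 <= j < N2.+1) F i j.

Definition guard (b : bool) (r : R) : R := if b then r else 0.

Definition sum2 (A1 A2 : nat -> nat -> R) : R :=
  grid_sum (fun i j => (A1 i j `^ p + A2 i j `^ p) `^ p^-1).

Definition sum3 (B1 B2 B3 : nat -> nat -> R) : R :=
  grid_sum (fun i j =>
    (B1 i j `^ p + B2 i j `^ p + 2 `^ (1 - p) * B3 i j `^ p) `^ p^-1).

End Costs.

Section EuclideanTGV.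
Variables (R : realType) (K : nat).
Variables (p : R) (N1 N2 : nat) (alpha0 alpha1 : R).
Local Notation signal := (nat -> nat -> 'rV[R]_K).

Definition TGV_cost (u w1 w2 : signal) : R :=
  alpha1 * sum2 p N1 N2
    (fun i j => guard (in_1 N1 N2 i j) (enorm (u i.+1 j - u i j - w1 i j)))
    (fun i j => guard (in_2 N1 N2 i j) (enorm (u i j.+1 - u i j - w2 i j)))
  + alpha0 * sum3 p N1 N2
    (fun i j => guard (in_D1 N1 N2 i j) (enorm (w1 i.-1 j - w1 i j)))
    (fun i j => guard (in_D2 N1 N2 i j) (enorm (w2 i j.-1 - w2 i j)))
    (fun i j => guard (in_D3 N1 N2 i j)
       (enorm ((w1 i j.-1 - w1 i j) + (w2 i.-1 j - w2 i j)))).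

Definition TGV (u : signal) : set R :=
  minimum [set r | exists w1 w2, r = TGV_cost u w1 w2].

Definition TV2_euclidean (u : signal) : R :=
  sum3 p N1 N2
    (fun i j => guard [&& in_u N1 N2 i.+1 j, in_u N1 N2 i j & in_u N1 N2 i.-1 j]
       (enorm (u i.+1 j - u i j *+ 2 + u i.-1 j)))
    (fun i j => guard [&& in_u N1 N2 i j.+1, in_u N1 N2 i j & in_u N1 N2 i j.-1]
       (enorm (u i j.+1 - u i j *+ 2 + u i j.-1)))
    (fun i j => guard
       [&& in_u N1 N2 i.+1 j, in_u N1 N2 i j, in_u N1 N2 i.+1 j.-1,
           in_u N1 N2 i j.-1, in_u N1 N2 i j.+1, in_u N1 N2 i.-1 j.+1
         & in_u N1 N2 i.-1 j]
       (enorm ((u i.+1 j - u i j) - (u i.+1 j.-1 - u i j.-1)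
               + (u i j.+1 - u i j) - (u i.-1 j.+1 - u i.-1 j)))).

End EuclideanTGV.

Section ManifoldTGV.
Variables (R : realType) (K : nat) (M : complete_manifold R K).
Local Notation signal := (nat -> nat -> 'rV[R]_K).

Section Functional.
Variables (p : R) (N1 N2 : nat).

Definition signal_in (range : nat -> nat -> bool) (u : signal) : Prop :=
  forall i j, range i j -> carrier M (u i j).

Definition guard_set (b : bool) (S : set R) : set R := if b then S else [set 0].

(* The value of the functional minimized in PT-TGV. *)
Definition PTTGV_cost (alpha0 alpha1 : R) (u y1 y2 : signal) : set R :=
  [set r | exists B1 B2 B3 : nat -> nat -> R,
    (forall i j,
      [/\ guard_set (in_D1 N1 N2 i j)
            (Dpt M (u i j) (y1 i j) (u i.-1 j) (y1 i.-1 j)) (B1 i j),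
          guard_set (in_D2 N1 N2 i j)
            (Dpt M (u i j) (y2 i j) (u i j.-1) (y2 i j.-1)) (B2 i j)
        & guard_set (in_D3 N1 N2 i j)
            (Dptsym M (u i j) (y1 i j) (u i j) (y2 i j)
                      (u i j.-1) (y1 i j.-1) (u i.-1 j) (y2 i.-1 j)) (B3 i j)])
    /\ r = alpha1 * sum2 p N1 N2
             (fun i j => guard (in_1 N1 N2 i j) (rdist M (u i.+1 j) (y1 i j)))
             (fun i j => guard (in_2 N1 N2 i j) (rdist M (u i j.+1) (y2 i j)))
           + alpha0 * sum3 p N1 N2 B1 B2 B3].

Definition PTTGV (alpha0 alpha1 : R) (u : signal) : set R :=
  minimum [set r | exists y1 y2,
    [/\ signal_in (in_1 N1 N2) y1, signal_in (in_2 N1 N2) y2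
      & PTTGV_cost alpha0 alpha1 u y1 y2 r]].

Definition attained_at (alpha0 alpha1 : R) (u y1 y2 : signal) : Prop :=
  exists2 r, PTTGV_cost alpha0 alpha1 u y1 y2 r & PTTGV alpha0 alpha1 u r.

(* The first condition says that F is a functional of the signal
   (u_ij) for 1 <= i <= N1, 1 <= j <= N2. *)
Definition admissible_TV2 (F : signal -> R) : Prop :=
  (forall u v : signal,
     (forall i j, in_u N1 N2 i j -> u i j = v i j) -> F u = F v) /\
  (euclidean M -> forall u, F u = TV2_euclidean p N1 N2 u).

End Functional.

(* The sequence (v_i) for 0 <= i <= n. For L = 0 the geodesic, defined on
   [0, 0], is a single point. *)
Definition geodesic_seq (n : nat) (v : nat -> 'rV[R]_K) : Prop :=
  exists (L : R) (c : R -> 'rV[R]_K),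
    [/\ 0 <= L,
        0 < L -> geodesic M c /\ (forall t, tnorm M (c t) (derive1 c t) = 1),
        forall i, (i <= n)%N -> c (i%:R * L / n%:R) = v i
      & forall i, (i < n)%N -> rdist M (v i) (v i.+1) = L / n%:R].

Definition locally_geodesic_seq (n : nat) (v : nat -> 'rV[R]_K) : Prop :=
  forall i, (1 <= i < n)%N -> geodesic_seq 2 (fun k => v (i.-1 + k)%N).

(* The third sequence is (u_(i0+k, j0-k)) for -a <= k <= b, shifted by a. *)
Definition all_lines (N1 N2 : nat)
    (P : nat -> (nat -> 'rV[R]_K) -> Prop) (u : signal) : Prop :=
  forall i0 j0, in_u N1 N2 i0 j0 ->
    let a := minn (i0 - 1) (N2 - j0) in
    let b := minn (N1 - i0) (j0 - 1) in
    [/\ P N1.-1 (fun k => u k.+1 j0),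
        P N2.-1 (fun k => u i0 k.+1)
      & P (a + b)%N (fun k => u (i0 - a + k)%N (j0 + a - k)%N)].

Definition geodesic_signal (N1 N2 : nat) (u : signal) : Prop :=
  all_lines N1 N2 geodesic_seq u.

Definition locally_geodesic_signal (N1 N2 : nat) (u : signal) : Prop :=
  all_lines N1 N2 locally_geodesic_seq u.

Definition unique_min_geodesic (x y : 'rV[R]_K) : Prop :=
  exists2 c, min_geodesic M c x y &
    forall c', min_geodesic M c' x y ->
      forall t : R, 0 <= t <= 1 -> c' t = c t.

Definition near_unique_geodesics (N1 N2 : nat) (u : signal) : Prop :=
  forall i j i' j', in_u N1 N2 i j -> in_u N1 N2 i' j' ->
    (i <= i' + 2)%N -> (i' <= i + 2)%N -> (j <= j' + 2)%N -> (j' <= j + 2)%N ->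
    unique_min_geodesic (u i j) (u i' j').

End ManifoldTGV.

(* Main.v *)
Require Import Defs.
From mathcomp Require Import all_boot all_order all_algebra.
From mathcomp Require Import all_classical all_reals all_analysis.
From mathcomp Require Import zify ring lra.

Set Implicit Arguments.
Unset Strict Implicit.
Unset Printing Implicit Defensive.

Import Order.TTheory GRing.Theory Num.Theory.
Import numFieldNormedType.Exports.

Local Open Scope classical_set_scope.
Local Open Scope ring_scope.

(** The functional is a sum of nonnegative terms, and everything rests on
    evaluating the terms on special configurations. Since the Levi-Civita
    connection preserves the metric, parallel fields have constant norms and
    inner products. It follows that a geodesic has constant speed, that the
    distance between two points is the speed on [0, 1] of any minimizing geodesic
    joining them, and that a parallel field is determined by one of its values.
    Three points x, y, z are called aligned when minimizing geodesics from x to y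
    and from y to z continue each other with the same velocity at y.

    In Euclidean space the connection vanishes ([euclidean_conn0]), so geodesics
    are lines, parallel transport is the identity, and each D_pt or D_pt^sym is
    the set containing one norm. With w = y - u, the cost becomes the cost of the
    vector-space TGV term by term ([euclidean_PTTGV_cost]). The minimum of the
    latter exists by coercivity of the data term and compactness
    ([TGV_attained]).

    If y1 = y2 = u, all logarithms, transported vectors and exponentials are
    trivial, so every D_pt and D_pt^sym term is 0. If y1 and y2 are the shifted
    signals, the distances vanish instead, and TV^2 is the value of the remaining
    terms; it is well defined because a minimum is unique, and in Euclidean space
    it is the required formula ([TV2_admissible]).

    Let u be locally geodesic. Consecutive points on rows, columns and
    antidiagonals are aligned, so the D_pt terms of the shifted signals contain 0
    ([aligned_Dpt]). In D_pt^sym, transporting the forward velocity backwards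
    along a row or a column and applying the exponential returns to u_ij, and the
    remaining D_pt compares three aligned antidiagonal points
    ([aligned_Dptsym]).

    Conversely, if the minimum is 0, all terms vanish, so y1 and y2 are the
    shifted signals. Uniqueness of the short geodesics forces every transported
    vector to be the velocity of the geodesic concerned, and a vanishing D_pt
    says that three points are aligned ([Dpt0_aligned]). For D_pt^sym one must
    know that the exponential of the transported vector is u_ij, that is, that
    geodesics are determined by position and velocity ([geodesic_unique]); the
    coefficients of the geodesic equation are smooth, hence locally Lipschitz,
    and a contraction argument on short intervals gives local uniqueness. A
    sequence whose consecutive triples are aligned is geodesic, because the
    minimizing geodesics can be spliced at the points of the sequence: equal
    velocities imply equal accelerations ([geodesic_splice],
    [aligned_geodesic_seq]). *)

(** * Derivatives of vector-valued curves *)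

Section Curves.
Variables (R : realType) (K : nat).
Local Notation vec := 'rV[R]_K.
Implicit Types (c f g : R -> vec).

(** Unlike [is_derive], the limit of difference quotients can be combined
    pointwise near [t], as splicing two curves requires. *)
Lemma is_deriveP (V : normedModType R) (f : R -> V) (t : R) (v : V) :
  is_derive t (1 : R) f v <-> h^-1 *: (f (h + t) - f t) @[h --> 0^'] --> v.
Proof.
have E : (fun h : R => h^-1 *: ((f \o shift t) (h *: (1 : R)) - f t)) =
         (fun h => h^-1 *: (f (h + t) - f t)).
  by apply/funext => h /=; rewrite [_%:A]mulr1.
split=> [[fd <-]|fv].
  rewrite -E /derive; exact: fd.
have fd : derivable f t 1 by rewrite /derivable E; apply/cvg_ex; exists v.
apply: DeriveDef => //; rewrite /derive E; exact: cvg_lim.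
Qed.

Lemma is_derive_derive1 (V : normedModType R) (f : R -> V) (t : R) :
  derivable f t 1 -> is_derive t (1 : R) f (derive1 f t).
Proof. by move=> ft; rewrite derive1E; exact: derivableP. Qed.

Lemma derive1_val (V : normedModType R) (f : R -> V) (t : R) (v : V) :
  is_derive t (1 : R) f v -> derive1 f t = v.
Proof. by move=> [_ <-]; rewrite derive1E. Qed.

Lemma is_derive_mxP m n (A : R -> 'M[R]_(m, n)) t (dA : 'M[R]_(m, n)) :
  is_derive t (1 : R) A dA <->
  forall i j, is_derive t (1 : R) (fun s => A s i j) (dA i j).
Proof.
split=> [[Ad <-] i j|dAij].
  apply: DeriveDef; first by move/derivable_mxP : Ad; exact.
  by rewrite derive_mx// mxE.
have Ad : derivable A t 1.
  by apply/derivable_mxP => i j; exact: ex_derive.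
apply: DeriveDef => //; rewrite derive_mx//; apply/matrixP => i j; rewrite mxE.
exact: derive_val.
Qed.

Lemma is_derive_rowP c t (v : vec) :
  is_derive t (1 : R) c v <->
  forall k, is_derive t (1 : R) (fun s => c s 0 k) (v 0 k).
Proof.
split=> [/is_derive_mxP cv k|cv]; first exact: cv.
by apply/is_derive_mxP => i k; rewrite (ord1 i).
Qed.

Lemma is_derive_continuous (V : normedModType R) (f : R -> V) (t : R) (v : V) :
  is_derive t (1 : R) f v -> {for t, continuous f}.
Proof.
by move=> [fd _]; apply: differentiable_continuous; exact/derivable1_diffP.
Qed.

Lemma derive0_constant c :
  (forall t, is_derive t (1 : R) c 0) -> forall s t, c s = c t.
Proof.
move=> c0 s t; apply/rowP => k; apply: (is_derive_0_is_cst (f := fun s => c s 0 k)).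
by move=> r; have /is_derive_rowP/(_ k) := c0 r; rewrite mxE.
Qed.

Lemma is_derive_affine c (a b t : R) (v : vec) :
  is_derive (a * t + b) (1 : R) c v ->
  is_derive t (1 : R) (fun s => c (a * s + b)) (a *: v).
Proof.
move=> /is_derive_rowP cv; apply/is_derive_rowP => k.
rewrite mxE mulrC.
have ab : is_derive t (1 : R) (fun s : R => a * s + b) a.
  apply: is_derive_eq; last by rewrite addr0 [_ *: _]mulr1.
exact: (@is_derive1_comp _ (fun s => c s 0 k) (fun s => a * s + b)).
Qed.

Lemma is_derive_line (x v : vec) (t : R) :
  is_derive t (1 : R) (fun s : R => x + s *: v) v.
Proof.
apply/is_derive_rowP => k.
rewrite [X in is_derive _ _ X _](_ : _ = fun s => x 0 k + s * v 0 k).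
  by apply: is_derive_eq; rewrite scaler0 !add0r mul1r [_ *: _]mulr1.
by apply/funext => s; rewrite !mxE.
Qed.

Definition splice (x : R) (T : Type) (f g : R -> T) (t : R) : T :=
  if t <= x then f t else g t.

Lemma spliceL (x : R) (T : Type) (f g : R -> T) t :
  t <= x -> splice x f g t = f t.
Proof. by rewrite /splice => ->. Qed.

Lemma spliceR (x : R) (T : Type) (f g : R -> T) t :
  x < t -> splice x f g t = g t.
Proof. by rewrite /splice leNgt => ->. Qed.

(** The difference quotients of the spliced curve at [x] are those of [f] or
    those of [g], which have the same limit. *)
Lemma is_derive_splice (V : normedModType R) (f g : R -> V) (x : R) (v : V) :
  f x = g x -> is_derive x (1 : R) f v -> is_derive x (1 : R) g v ->
  is_derive x (1 : R) (splice x f g) v.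
Proof.
move=> fgx /is_deriveP/cvgrPdist_le fv /is_deriveP/cvgrPdist_le gv.
apply/is_deriveP/cvgrPdist_le => e e0.
have fe := fv e e0; have ge := gv e e0; near=> h.
rewrite /splice lexx; case: ifP => _; first by near: h.
by rewrite fgx; near: h.
Unshelve. all: by end_near. Qed.

Lemma is_derive_splicel (V : normedModType R) (f g : R -> V) (x t : R) (v : V) :
  t < x -> is_derive t (1 : R) f v -> is_derive t (1 : R) (splice x f g) v.
Proof.
move=> tx; apply: near_eq_is_derive; near=> s; rewrite /splice ifT//.
by apply/ltW; near: s; exact: lt_nbhsl.
Unshelve. all: by end_near. Qed.

Lemma is_derive_splicer (V : normedModType R) (f g : R -> V) (x t : R) (v : V) :
  x < t -> is_derive t (1 : R) g v -> is_derive t (1 : R) (splice x f g) v.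
Proof.
move=> xt; apply: near_eq_is_derive; near=> s; rewrite /splice ifF//.
by apply/negbTE; rewrite -ltNge; near: s; exact: lt_nbhsr.
Unshelve. all: by end_near. Qed.

Lemma norm_le_entries m n (A : 'M[R]_(m, n)) (b : R) :
  0 <= b -> (forall i j, `|A i j| <= b) -> `|A| <= b.
Proof.
move=> b0 Ab; rewrite [leLHS]/Num.Def.normr/= mx_normrE.
by apply: bigmax_le => // -[i j] _ /=.
Qed.

Lemma entry_le_norm m n (A : 'M[R]_(m, n)) i j : `|A i j| <= `|A|.
Proof.
rewrite [leRHS]/Num.Def.normr/= mx_normrE.
exact: (le_bigmax _ (fun ij : 'I_m * 'I_n => `|A ij.1 ij.2|) (i, j)).
Qed.

(** The norm is the maximum of the entries, so the scalar mean value theorem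
    applies entry by entry, with a different intermediate point each time. *)
Lemma mean_value_bound m n (A dA : R -> 'M[R]_(m, n)) (a b B : R) :
  a <= b -> 0 <= B ->
  (forall t, a <= t <= b -> is_derive t (1 : R) A (dA t)) ->
  (forall t, a <= t <= b -> `|dA t| <= B) -> `|A b - A a| <= B * (b - a).
Proof.
move=> ab B0 Ad dAB; apply: norm_le_entries => [|i j].
  by rewrite mulr_ge0// subr_ge0.
have Adij t : a <= t <= b -> is_derive t (1 : R) (fun s => A s i j) (dA t i j).
  by move=> /Ad/is_derive_mxP; exact.
have [x xab| |x] := @MVT_segment _ (fun s => A s i j) (fun t => dA t i j) _ _ ab.
- by apply: Adij; move: xab; rewrite in_itv/= => /andP[/ltW -> /ltW ->].
- rewrite continuous_subspace_in => y; rewrite inE/= in_itv/= => yab.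
  apply: continuous_in_subspaceT => // z; rewrite inE/= in_itv/= => zab.
  exact: is_derive_continuous (Adij z zab).
rewrite in_itv/= => xab; rewrite !mxE => ->.
rewrite normrM (ger0_norm (_ : 0 <= b - a)) ?subr_ge0//.
rewrite ler_wpM2r ?subr_ge0//.
exact: le_trans (entry_le_norm _ _ _) (dAB x xab).
Qed.

Lemma mean_value_bound_ball m n (A dA : R -> 'M[R]_(m, n)) (a r B : R) :
  0 <= B -> (forall t, `|t - a| <= r -> is_derive t (1 : R) A (dA t)) ->
  (forall t, `|t - a| <= r -> `|dA t| <= B) ->
  forall b, `|b - a| <= r -> `|A b - A a| <= B * `|b - a|.
Proof.
move=> B0 Ad dAB b bar; have [ab|ba] := leP a b.
  rewrite (ger0_norm (_ : 0 <= b - a)) ?subr_ge0//.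
  move: bar; rewrite (ger0_norm (_ : 0 <= b - a)) ?subr_ge0// => bar.
  have H t : a <= t <= b -> `|t - a| <= r.
    by move=> /andP[at_ tb]; rewrite ger0_norm; lra.
  by apply: (mean_value_bound ab B0) => t /H; [exact: Ad|exact: dAB].
have {}ba := ltW ba.
rewrite distrC (ler0_norm (_ : b - a <= 0)) ?subr_le0// opprB.
move: bar; rewrite (ler0_norm (_ : b - a <= 0)) ?subr_le0// => bar.
have H t : b <= t <= a -> `|t - a| <= r.
  by move=> /andP[bt ta]; rewrite ler0_norm; lra.
by apply: (mean_value_bound ba B0) => t /H; [exact: Ad|exact: dAB].
Qed.

End Curves.

(** * Tangent spaces *)

Section TangentSpaces.
Variables (R : realType) (K : nat).
Local Notation vec := 'rV[R]_K.

(** The tangent space is the range of the differential of a chart [phi]: a curve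
    in [X] is locally [phi \o (psi \o c)], and conversely [phi] maps line
    segments to curves in [X]. This makes the set of velocities a subspace. *)
Lemma tangent_space_linear m (X : set vec) (x : vec) :
  submanifold m X -> X x ->
  exists L : {linear 'rV[R]_m -> vec}, forall v,
    tangent X x v <-> exists a, v = L a.
Proof.
move=> Xsub Xx.
have [U [W [phi [psi [[oU oW Wx sphi spsi] [phiX psiK phiK]]]]]] := Xsub x Xx.
have [Upx phipx] := phiK x Xx Wx.
have dphi : differentiable phi (psi x) by case: (sphi 1%N) => + _; exact.
have dpsi : differentiable psi x by case: (spsi 1%N) => + _; exact.
exists ('d phi (psi x)) => v; split=> [[c [cX c0 cv]]|[a ->]].
- have cc : {for 0, continuous c} := is_derive_continuous cv.
  have Wc : \forall t \near (0 : R), W (c t).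
    by apply: (cc W); rewrite c0; exact: open_nbhs_nbhs.
  have {}cv : is_derive (0 : R) (1 : R) (phi \o (psi \o c)) v.
    apply: near_eq_is_derive cv; near=> t => /=.
    by rewrite (phiK (c t) _ _).2//; near: t.
  have dc : differentiable c (0 : R).
    apply/derivable1_diffP.
    by apply: (@near_eq_derivable _ _ _ (phi \o (psi \o c))) => //=;
      near=> t; rewrite /= (phiK (c t) _ _).2//; near: t.
  exists ('d psi x ('d c (0 : R) 1)).
  subst x; have dpc := differentiable_comp dc dpsi.
  case: cv => _ <-; rewrite deriveE; last exact: (differentiable_comp dpc dphi).
  have E1 := congr1 (fun f => f 1) (diff_comp dpc dphi).
  have E2 := congr1 (fun f => f 1) (diff_comp dc dpsi).
  by refine (etrans E1 _); rewrite /= in E2; rewrite /= -E2.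
exists (fun t : R => phi (psi x + t *: a)).
have dl := is_derive_line (psi x) a 0.
split.
- have lc : {for 0, continuous (fun t : R => psi x + t *: a)}.
    exact: is_derive_continuous dl.
  have lU : \forall t \near (0 : R), U (psi x + t *: a).
    by apply: (lc U); rewrite scale0r addr0; exact: open_nbhs_nbhs.
  by near=> t; apply: (phiX _ _).1; near: t.
- by rewrite scale0r addr0.
have dl' : differentiable (fun t : R => psi x + t *: a) 0.
  by apply/derivable1_diffP; case: dl.
have dphi' : differentiable phi (psi x + 0 *: a) by rewrite scale0r addr0.
have dpl := differentiable_comp dl' dphi'.
apply: DeriveDef; first exact/derivable1_diffP.
rewrite deriveE//; have E1 := congr1 (fun f => f 1) (diff_comp dl' dphi').
refine (etrans E1 _) => /=; rewrite -(deriveE _ dl') scale0r addr0.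
by congr ('d phi (psi x) _); case: dl.
Unshelve. all: by end_near. Qed.

End TangentSpaces.

(** * Metric and connection *)

Section Connection.
Variables (R : realType) (K : nat) (M : complete_manifold R K).
Local Notation vec := 'rV[R]_K.
Local Notation X := (carrier M).
Local Notation g := (metric M).
Local Notation C := (conn M).
Local Notation D := (covd (conn M)).
Implicit Types (c V W : R -> vec).

Lemma tangent_lin x a v w :
  X x -> tangent X x v -> tangent X x w -> tangent X x (a *: v + w).
Proof.
move=> Xx.
have [L TL] := tangent_space_linear (@carrier_submanifold _ _ M) Xx.
move=> /TL[b ->] /TL[b' ->]; apply/TL; exists (a *: b + b').
by rewrite linearP.
Qed.

Lemma tangent0 x : X x -> tangent X x 0.
Proof.
move=> Xx.
have [L TL] := tangent_space_linear (@carrier_submanifold _ _ M) Xx.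
by apply/TL; exists 0; rewrite linear0.
Qed.

Lemma tangentZ x a v : X x -> tangent X x v -> tangent X x (a *: v).
Proof.
by move=> Xx Tv; have := tangent_lin a Xx Tv (tangent0 Xx); rewrite addr0.
Qed.

Lemma tangentB x v w :
  X x -> tangent X x v -> tangent X x w -> tangent X x (v - w).
Proof.
by move=> Xx Tv Tw; have := tangent_lin (-1) Xx Tw Tv; rewrite scaleN1r addrC.
Qed.

Lemma tangent_velocity c t : curve_in X c -> tangent X (c t) (derive1 c t).
Proof.
move=> cX; exists (fun s => c (1 * s + t)); split.
- by near=> s; case: (cX (1 * s + t)).
- by rewrite mulr0 add0r.
- rewrite -[X in is_derive _ _ _ X]scale1r; apply: is_derive_affine.
  by rewrite mulr0 add0r; apply: is_derive_derive1; case: (cX t).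
Unshelve. all: by end_near. Qed.

Lemma smooth_form_matrix (b : vec -> vec -> vec -> R) x :
  smooth_form X b -> X x -> exists G : 'M[R]_K, forall v w,
    tangent X x v -> tangent X x w -> b x v w = (v *m G *m w^T) 0 0.
Proof.
move=> sb /[dup] Xx /sb[U [G [_ Ux _ bG]]]; exists (G x) => v w.
exact: bG.
Qed.

Lemma metric_linl x a u v w : X x ->
  tangent X x u -> tangent X x v -> tangent X x w ->
  g x (a *: u + v) w = a * g x u w + g x v w.
Proof.
move=> Xx Tu Tv Tw; case: (metric_riemannian M) => gs _ _.
have [G gG] := smooth_form_matrix gs Xx.
rewrite !gG//; last exact: tangent_lin.
rewrite !mulmxDl -!scalemxAl mxE; congr (_ + _).
by rewrite mxE.
Qed.

Lemma metricC x v w : X x ->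
  tangent X x v -> tangent X x w -> g x v w = g x w v.
Proof. by case: (metric_riemannian M) => _ + _; exact. Qed.

Lemma metricZ x a v : X x -> tangent X x v ->
  g x (a *: v) (a *: v) = a ^+ 2 * g x v v.
Proof.
move=> Xx Tv; have T0 := tangent0 Xx; have Ta := tangentZ a Xx Tv.
have E w : tangent X x w -> g x 0 w = 0.
  move=> Tw; have := metric_linl 1 Xx T0 T0 Tw.
  by rewrite scaler0 addr0 mul1r => /eqP; rewrite eq_sym -subr_eq0 addrK => /eqP.
have H w : tangent X x w -> g x (a *: v) w = a * g x v w.
  by move=> Tw; have := metric_linl a Xx Tv T0 Tw; rewrite addr0 E// addr0.
by rewrite H// metricC// H// mulrA.
Qed.

Lemma metric0 x : X x -> g x 0 0 = 0.
Proof.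
by move=> Xx; have := metricZ 0 Xx (tangent0 Xx); rewrite scaler0 expr0n mul0r.
Qed.

Lemma tnorm0 x : X x -> tnorm M x 0 = 0.
Proof. by move=> Xx; rewrite /tnorm metric0// sqrtr0. Qed.

Lemma metric_ge0 x v : X x -> tangent X x v -> 0 <= g x v v.
Proof.
move=> Xx Tv; have [->|v0] := eqVneq v 0; first by rewrite metric0.
by apply: ltW; case: (metric_riemannian M) => _ _; exact.
Qed.

Lemma tnorm_ge0 x v : 0 <= tnorm M x v.
Proof. exact: sqrtr_ge0. Qed.

Lemma tnormZ x a v : X x -> tangent X x v ->
  tnorm M x (a *: v) = `|a| * tnorm M x v.
Proof.
by move=> Xx Tv; rewrite /tnorm metricZ// sqrtrM ?sqr_ge0// sqrtr_sqr.
Qed.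

Lemma metric_eq0 x v : X x -> tangent X x v -> g x v v = 0 -> v = 0.
Proof.
move=> Xx Tv g0; apply/eqP; apply/contraT => v0; move: g0.
by case: (metric_riemannian M) => _ _ /(_ x v Xx Tv v0) + g0; rewrite g0 ltxx.
Qed.

Lemma tnorm_eq0 x v : X x -> tangent X x v -> tnorm M x v = 0 -> v = 0.
Proof.
move=> Xx Tv /eqP; rewrite sqrtr_eq0 => g0; apply: (metric_eq0 Xx Tv).
by apply/eqP; rewrite eq_le g0 metric_ge0//.
Qed.

Lemma conn_lin x a b u v w : X x ->
  tangent X x u -> tangent X x v -> tangent X x w ->
  C x (b *: u) (a *: v + w) = (b * a) *: C x u v + b *: C x u w.
Proof.
move=> Xx Tu Tv Tw; case: (conn_levi_civita M) => -[Cs _] _ _.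
apply/rowP => k; have [G CG] := smooth_form_matrix (Cs k) Xx.
have Tb := tangentZ b Xx Tu.
rewrite !mxE !CG//; last exact: tangent_lin.
rewrite linearD linearZ/= -!scalemxAl mulmxDr -scalemxAr scalerDr scalerA mxE.
by congr (_ + _); rewrite mxE.
Qed.

Lemma conn_linr x a u v w : X x ->
  tangent X x u -> tangent X x v -> tangent X x w ->
  C x u (a *: v + w) = a *: C x u v + C x u w.
Proof.
by move=> Xx Tu Tv Tw; have := conn_lin a 1 Xx Tu Tv Tw; rewrite mul1r !scale1r.
Qed.

Lemma connZ x a b u v : X x -> tangent X x u -> tangent X x v ->
  C x (b *: u) (a *: v) = (b * a) *: C x u v.
Proof.
move=> Xx Tu Tv; have T0 := tangent0 Xx.
have E : C x u 0 = 0.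
  have := conn_linr 1 Xx Tu T0 T0; rewrite scaler0 addr0 scale1r.
  by move=> /eqP; rewrite eq_sym -subr_eq0 addrK => /eqP.
by have := conn_lin a b Xx Tu Tv T0; rewrite addr0 E scaler0 addr0.
Qed.

(** * Parallel fields *)

Lemma curve_inX c t : curve_in X c -> X (c t).
Proof. by move=> /(_ t)[]. Qed.

Lemma parallel_lin c a V W : curve_in X c ->
  parallel M c V -> parallel M c W -> parallel M c (fun t => a *: V t + W t).
Proof.
move=> cX [fV dV] [fW dW].
have dVt t : is_derive t (1 : R) V (derive1 V t).
  by apply: is_derive_derive1; case: (fV t).
have dWt t : is_derive t (1 : R) W (derive1 W t).
  by apply: is_derive_derive1; case: (fW t).
have dVW t : is_derive t (1 : R) (fun t => a *: V t + W t)
    (a *: derive1 V t + derive1 W t).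
  by have := is_deriveD (is_deriveZ a (dVt t)) (dWt t).
split=> [t|t].
  split; last by case: (dVW t).
  by apply: tangent_lin; [exact: curve_inX|case: (fV t)|case: (fW t)].
rewrite /covd (derive1_val (dVW t)) conn_linr//; last 4 first.
- exact: curve_inX.
- exact: tangent_velocity.
- by case: (fV t).
- by case: (fW t).
move: (dV t) (dW t); rewrite /covd => EV EW.
by rewrite addrACA -scalerDr EV EW scaler0 addr0.
Qed.

(** Metric compatibility makes the derivative of the product vanish. *)
Lemma parallel_product c V W : curve_in X c -> parallel M c V ->
  parallel M c W -> forall s t, g (c s) (V s) (W s) = g (c t) (V t) (W t).
Proof.
move=> cX [fV dV] [fW dW] s t.
apply: (is_derive_0_is_cst (f := fun s => g (c s) (V s) (W s))) => r.
case: (conn_levi_civita M) => _ _ /(_ c V W r cX fV fW).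
rewrite dV dW; have Xr := curve_inX r cX; have T0 := tangent0 Xr.
have TV : tangent X (c r) (V r) by case: (fV r).
have TW : tangent X (c r) (W r) by case: (fW r).
have E w : tangent X (c r) w -> g (c r) 0 w = 0.
  move=> Tw; have := metric_linl 1 Xr T0 T0 Tw.
  by rewrite scaler0 addr0 mul1r => /eqP; rewrite eq_sym -subr_eq0 addrK => /eqP.
by rewrite (metricC Xr TV T0) !E// addr0.
Qed.

Lemma parallel_tnorm c V : curve_in X c -> parallel M c V ->
  forall s t, tnorm M (c s) (V s) = tnorm M (c t) (V t).
Proof. by move=> cX pV s t; rewrite /tnorm (parallel_product cX pV pV s t). Qed.

(** The difference of the two fields is parallel, so its norm is constant. *)
Lemma parallel_unique c V W t0 : curve_in X c -> parallel M c V ->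
  parallel M c W -> V t0 = W t0 -> forall t, V t = W t.
Proof.
move=> cX pV pW VW t; have pd := parallel_lin (-1) cX pV pW.
apply/eqP; rewrite -subr_eq0 -oppr_eq0 opprB addrC -scaleN1r; apply/eqP.
apply: (@metric_eq0 (c t)); first exact: curve_inX.
  by case: pd => /(_ t)[].
rewrite (parallel_product cX pd pd t t0) VW scaleN1r addNr.
by rewrite metric0//; exact: curve_inX.
Qed.

End Connection.

(** * Geodesics and the distance *)

Section Geodesics.
Variables (R : realType) (K : nat) (M : complete_manifold R K).
Local Notation vec := 'rV[R]_K.
Local Notation X := (carrier M).
Implicit Types (c V W : R -> vec).

Lemma geodesic_is_derive c t : geodesic M c ->
  is_derive t (1 : R) c (derive1 c t).
Proof. by move=> [cX _]; apply: is_derive_derive1; case: (cX t). Qed.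

Lemma geodesic_is_derive2 c t : geodesic M c ->
  is_derive t (1 : R) (derive1 c) (derive1 (derive1 c) t).
Proof. by move=> [_ c2]; apply: is_derive_derive1; case: (c2 t). Qed.

Lemma geodesic_parallel c : geodesic M c -> parallel M c (derive1 c).
Proof.
move=> [cX c2]; split=> [t|t]; last by case: (c2 t).
by split; [exact: tangent_velocity|case: (c2 t)].
Qed.

Lemma geodesicX c t : geodesic M c -> X (c t).
Proof. by move=> [cX _]; exact: curve_inX. Qed.

Lemma geodesic_tangent c t : geodesic M c -> tangent X (c t) (derive1 c t).
Proof. by move=> [cX _]; exact: tangent_velocity. Qed.

Lemma geodesic_speed c s t : geodesic M c ->
  tnorm M (c s) (derive1 c s) = tnorm M (c t) (derive1 c t).
Proof.
by move=> cg; apply: parallel_tnorm; [case: cg|exact: geodesic_parallel].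
Qed.

(** The speed is constant, so the integral is that of a constant on [0, 1]. All
    lengths are computed through this. *)
Lemma geodesic_length c : geodesic M c ->
  curve_length (metric M) c 0 1 = tnorm M (c 0) (derive1 c 0).
Proof.
move=> cg; rewrite /curve_length.
rewrite (@eq_Rintegral _ _ _ _ _ (fun=> tnorm M (c 0) (derive1 c 0))); last first.
  by move=> t _; exact: geodesic_speed.
rewrite Rintegral_cst//= lebesgue_measure_itv/= lte_fin ltr01.
by rewrite -EFinD/= subr0 mulr1.
Qed.

Lemma derive1_affine c a b t : derivable c (a * t + b) 1 ->
  derive1 (fun s => c (a * s + b)) t = a *: derive1 c (a * t + b).
Proof.
by move=> /is_derive_derive1 cd; apply: derive1_val; exact: is_derive_affine.
Qed.

Lemma geodesic_derive1_affine c a b : geodesic M c ->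
  derive1 (fun s => c (a * s + b)) = fun t => a *: derive1 c (a * t + b).
Proof.
by move=> [cX _]; apply/funext => t; apply: derive1_affine; case: (cX (a * t + b)).
Qed.

Lemma geodesic_affine c a b : geodesic M c ->
  geodesic M (fun s => c (a * s + b)).
Proof.
move=> cg; have cX t : X (c t) := geodesicX t cg.
have cd t := geodesic_is_derive t cg.
have d2 t : is_derive t (1 : R) (derive1 (fun s => c (a * s + b)))
    (a *: (a *: derive1 (derive1 c) (a * t + b))).
  rewrite geodesic_derive1_affine//.
  apply: is_deriveZ; apply: is_derive_affine; exact: geodesic_is_derive2.
split=> [t|t].
  by split=> //; have [] := is_derive_affine (cd (a * t + b)).
split; first by case: (d2 t).
rewrite /covd (derive1_val (d2 t)) geodesic_derive1_affine//.
rewrite connZ//; [|exact: geodesic_tangent..].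
case: cg => _ /(_ (a * t + b))[_]; rewrite /covd => E.
by rewrite scalerA -scalerDr E scaler0.
Qed.

Lemma geodesic_cst x : X x -> geodesic M (fun=> x).
Proof.
move=> Xx; have E : derive1 (fun _ : R => x) = fun=> 0.
  by apply/funext => t; exact: derive1_cst.
split=> [t|t]; first by split=> //; exact: derivable_cst.
rewrite E; split; first exact: derivable_cst.
rewrite /covd E derive1_cst add0r.
have := connZ 0 0 Xx (tangent0 Xx) (tangent0 Xx).
by rewrite scaler0 mul0r scale0r.
Qed.

Lemma rest_geodesic c : geodesic M c -> derive1 c 0 = 0 -> forall t, c t = c 0.
Proof.
move=> cg c0 t; apply: derive0_constant => s.
suff <- : derive1 c s = 0 by exact: geodesic_is_derive.
apply: (@tnorm_eq0 _ _ M (c s)); [exact: geodesicX|exact: geodesic_tangent|].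
by rewrite (geodesic_speed s 0 cg) c0 tnorm0//; exact: geodesicX.
Qed.

Lemma min_geodesicP c x y : min_geodesic M c x y <->
  [/\ geodesic M c, c 0 = x, c 1 = y & tnorm M x (derive1 c 0) = rdist M x y].
Proof.
split=> [[cg c0 c1 cl]|[cg c0 c1 cl]].
  by split=> //; rewrite -c0 -geodesic_length// c0.
by split=> //; rewrite geodesic_length// c0.
Qed.

Lemma rdist_le_speed c : geodesic M c ->
  rdist M (c 0) (c 1) <= tnorm M (c 0) (derive1 c 0).
Proof.
move=> cg; rewrite -geodesic_length//; apply: ge_inf.
  exists 0 => _ [c' [_ _ _ _ ->]].
  by apply: Rintegral_ge0 => t _; exact: sqrtr_ge0.
exists c; split=> //; first by case: cg.
by move=> t; apply: is_derive_continuous (geodesic_is_derive2 t cg).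
Qed.

Lemma min_geodesic_exists x y : X x -> X y -> exists c, min_geodesic M c x y.
Proof. exact: minimizing_geodesic_exists. Qed.

Lemma rdist_ge0 x y : X x -> X y -> 0 <= rdist M x y.
Proof.
move=> Xx Xy; have [c /min_geodesicP[_ _ _ <-]] := min_geodesic_exists Xx Xy.
exact: tnorm_ge0.
Qed.

(** A minimizing geodesic between points at distance 0 has speed 0. *)
Lemma rdist_eq0 x y : X x -> X y -> rdist M x y = 0 -> x = y.
Proof.
move=> Xx Xy; have [c /min_geodesicP[cg <- <- <-]] := min_geodesic_exists Xx Xy.
move=> /tnorm_eq0 c0; apply/esym/rest_geodesic => //; apply: c0.
  exact: geodesicX.
exact: geodesic_tangent.
Qed.

Lemma rdistxx x : X x -> rdist M x x = 0.
Proof.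
move=> Xx; apply/eqP; rewrite eq_le rdist_ge0// andbT.
have := rdist_le_speed (geodesic_cst Xx).
by rewrite derive1_cst tnorm0.
Qed.

Definition reversed (V : R -> vec) (t : R) : vec := V (-1 * t + 1).

Lemma reversed0 (V : R -> vec) : reversed V 0 = V 1.
Proof. by rewrite /reversed mulr0 add0r. Qed.

Lemma reversed1 (V : R -> vec) : reversed V 1 = V 0.
Proof. by rewrite /reversed mulr1 addNr. Qed.

Lemma geodesic_reversed c : geodesic M c -> geodesic M (reversed c).
Proof. exact: geodesic_affine. Qed.

Lemma derive1_reversed c : geodesic M c ->
  derive1 (reversed c) = fun t => - reversed (derive1 c) t.
Proof.
by move=> cg; rewrite geodesic_derive1_affine//; apply/funext => t; rewrite scaleN1r.
Qed.

Lemma reversed_speed c : geodesic M c ->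
  tnorm M (reversed c 0) (derive1 (reversed c) 0) = tnorm M (c 0) (derive1 c 0).
Proof.
move=> cg; rewrite derive1_reversed// !reversed0 -scaleN1r tnormZ; last 2 first.
- exact: geodesicX.
- exact: geodesic_tangent.
by rewrite normrN1 mul1r; exact: geodesic_speed.
Qed.

Lemma rdistC x y : X x -> X y -> rdist M x y = rdist M y x.
Proof.
suff H x' y' : X x' -> X y' -> rdist M x' y' <= rdist M y' x'.
  by move=> Xx Xy; apply/eqP; rewrite eq_le !H.
move=> Xx Xy; have [c /min_geodesicP[cg c0 c1 <-]] := min_geodesic_exists Xy Xx.
subst x' y'; have := rdist_le_speed (geodesic_reversed cg).
by rewrite reversed_speed// reversed0 reversed1.
Qed.

Lemma min_geodesic_reversed c x y : min_geodesic M c x y ->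
  min_geodesic M (reversed c) y x.
Proof.
move=> /min_geodesicP[cg c0 c1 cl]; apply/min_geodesicP; split.
- exact: geodesic_reversed.
- by rewrite reversed0.
- by rewrite reversed1.
subst x y; have := reversed_speed cg; rewrite reversed0 => ->.
by rewrite cl rdistC//; exact: geodesicX.
Qed.

(** Equal positions and velocities at [x] force equal accelerations there,
    because the geodesic equation expresses the acceleration through them; hence
    the spliced curve is twice differentiable. *)
Lemma geodesic_splice (x : R) c1 c2 : geodesic M c1 -> geodesic M c2 ->
  c1 x = c2 x -> derive1 c1 x = derive1 c2 x ->
  geodesic M (splice x c1 c2) /\
  derive1 (splice x c1 c2) = splice x (derive1 c1) (derive1 c2).
Proof.
move=> g1 g2 c12 d12.
have accel c t : geodesic M c ->
    derive1 (derive1 c) t = - conn M (c t) (derive1 c t) (derive1 c t).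
  by move=> [_ /(_ t)[_ /eqP]]; rewrite addr_eq0 => /eqP.
have D t : is_derive t (1 : R) (splice x c1 c2)
    (splice x (derive1 c1) (derive1 c2) t).
  have G1 := geodesic_is_derive t g1; have G2 := geodesic_is_derive t g2.
  have [tx|xt|tx] := ltgtP t x.
  - exact: is_derive_eq (is_derive_splicel _ tx G1) (esym (spliceL _ _ (ltW tx))).
  - exact: is_derive_eq (is_derive_splicer _ xt G2) (esym (spliceR _ _ xt)).
  - subst t; rewrite -d12 in G2.
    exact: is_derive_eq (is_derive_splice c12 G1 G2) (esym (spliceL _ _ (lexx x))).
have E : derive1 (splice x c1 c2) = splice x (derive1 c1) (derive1 c2).
  by apply/funext => t; exact: derive1_val.
have D2 t : is_derive t (1 : R) (splice x (derive1 c1) (derive1 c2))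
    (splice x (derive1 (derive1 c1)) (derive1 (derive1 c2)) t).
  have G1 := geodesic_is_derive2 t g1; have G2 := geodesic_is_derive2 t g2.
  have [tx|xt|tx] := ltgtP t x.
  - exact: is_derive_eq (is_derive_splicel _ tx G1) (esym (spliceL _ _ (ltW tx))).
  - exact: is_derive_eq (is_derive_splicer _ xt G2) (esym (spliceR _ _ xt)).
  - subst t; have a12 : derive1 (derive1 c2) x = derive1 (derive1 c1) x.
      by rewrite (accel _ _ g2) (accel _ _ g1) c12 d12.
    rewrite a12 in G2.
    exact: is_derive_eq (is_derive_splice d12 G1 G2) (esym (spliceL _ _ (lexx x))).
split; last exact: E.
split=> t.
  split; last by case: (D t).
  by rewrite /splice; case: ifP => _; exact: geodesicX.
rewrite E; split; first by case: (D2 t).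
rewrite /covd E (derive1_val (D2 t)) /splice; case: ifP => _.
  by case: g1 => _ /(_ t)[].
by case: g2 => _ /(_ t)[].
Qed.

End Geodesics.

(** * Local uniqueness for second-order equations *)

Section Uniqueness.
Variables (R : realType) (K : nat).
Local Notation vec := 'rV[R]_K.

Lemma near_norm_bound (T : topologicalType) (V : normedModType R) (f : T -> V)
    (x : T) :
  {for x, continuous f} -> \forall y \near x, `|f y| <= `|f x| + 1.
Proof.
move=> cf; near=> y.
have : `|f x - f y| < 1 by near: y; apply: cvgr_dist_lt => //; exact: cf.
have := ler_normB (f x) (f x - f y).
by rewrite opprB addrC subrK => ? ?; lra.
Unshelve. all: by end_near. Qed.

(** On a ball where the partial derivatives are bounded, the mean value
    inequality applies along segments. *)
Lemma smooth_locally_lipschitz p q (U : set vec) (f : vec -> 'M[R]_(p, q)) x :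
  open U -> smooth U f -> U x ->
  exists L : R, 0 <= L /\ exists2 r : R, 0 < r &
    forall y z, `|x - y| < r -> `|x - z| < r -> `|f y - f z| <= L * `|y - z|.
Proof.
move=> oU sf Ux.
pose D (i : 'I_K) (y : vec) : 'M[R]_(p, q) := derive f y (delta_mx 0 i).
have df y : U y -> differentiable f y by case: (sf 1%N) => + _; exact.
have cD i : {for x, continuous (D i)}.
  by case: (sf 1%N) => _ /(_ (delta_mx 0 i)); exact.
have nD : \forall y \near x, forall i, `|D i y| <= `|D i x| + 1.
  apply: (@filter_forall _ _ (fun i y => `|D i y| <= `|D i x| + 1) (nbhs x)
    (nbhs_filter x)) => i.
  exact: (@near_norm_bound vec 'M[R]_(p, q) (D i) x (cD i)).
have nU : \forall y \near x, U y by exact: open_nbhs_nbhs.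
have nUD : \forall y \near x, U y /\ forall i, `|D i y| <= `|D i x| + 1.
  exact: filterI nU nD.
move: nUD => /nbhs_ballP[r /= r0 rP].
exists (\sum_i (`|D i x| + 1)); split.
  by apply: sumr_ge0 => i _; rewrite addr_ge0.
exists r => // y z xy xz.
pose l (s : R) : vec := z + s *: (y - z).
have lr (s : R) : 0 <= s <= 1 -> ball x r (l s).
  move=> /andP[s0 s1]; rewrite -ball_normE /ball_ /= /l.
  have -> : x - (z + s *: (y - z)) = (1 - s) *: (x - z) + s *: (x - y).
    by apply/rowP => k; rewrite !mxE; ring.
  rewrite (le_lt_trans (ler_normD _ _))// !normrZ.
  rewrite (ger0_norm s0) (ger0_norm (_ : 0 <= 1 - s)) ?subr_ge0//.
  have [a am mr] : exists2 m, `|x - y| <= m /\ `|x - z| <= m & m < r.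
    by exists (Num.max `|x - y| `|x - z|); rewrite ?le_max ?lexx ?orbT// gt_max xy.
  case: am => ym zm; have s1' : 0 <= 1 - s by rewrite subr_ge0.
  have zm' : 0 <= a - `|x - z| by rewrite subr_ge0.
  have ym' : 0 <= a - `|x - y| by rewrite subr_ge0.
  by have := mulr_ge0 s1' zm'; have := mulr_ge0 s0 ym'; lra.
have dl (s : R) : 0 <= s <= 1 -> is_derive s (1 : R) (f \o l)
    (\sum_i (y - z) 0 i *: D i (l s)).
  move=> /lr/rP[Ul _].
  have dl := is_derive_line z (y - z) s.
  have dl' : differentiable l s by apply/derivable1_diffP; case: dl.
  have dfl := differentiable_comp dl' (df _ Ul).
  apply: DeriveDef; first exact/derivable1_diffP.
  rewrite deriveE//; have E1 := congr1 (fun h => h 1) (diff_comp dl' (df _ Ul)).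
  refine (etrans E1 _) => /=; rewrite -(deriveE _ dl').
  have -> : 'D_1 l s = y - z by case: dl.
  rewrite [in LHS](row_sum_delta (y - z)) linear_sum/=; apply: eq_bigr => i _.
  by rewrite linearZ/= /D deriveE//; exact: df.
have := @mean_value_bound R p q (f \o l) (fun s => \sum_i (y - z) 0 i *: D i (l s))
  0 1 ((\sum_i (`|D i x| + 1)) * `|y - z|) ler01 _ dl.
have -> : (f \o l) 1 = f y by rewrite /= /l scale1r addrC subrK.
have -> : (f \o l) 0 = f z by rewrite /= /l scale0r addr0.
rewrite subr0 mulr1; apply.
  by rewrite mulr_ge0// sumr_ge0// => i _; rewrite addr_ge0.
move=> s /lr/rP[_ Dl]; rewrite mulr_suml.
apply: le_trans (ler_norm_sum _ _ _) _; apply: ler_sum => i _.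
by rewrite normrZ mulrC ler_pM// entry_le_norm.
Qed.

Lemma bilinear_entry_bound (G : 'M[R]_K) (v w : vec) :
  `|(v *m G *m w^T) 0 0| <= K%:R ^+ 2 * (`|v| * `|G| * `|w|).
Proof.
have -> : K%:R ^+ 2 * (`|v| * `|G| * `|w|) =
    \sum_(j < K) \sum_(i < K) (`|v| * `|G| * `|w|).
  by rewrite !sumr_const !card_ord -mulrnA -[RHS]mulr_natl natrM expr2.
rewrite mxE; apply: le_trans (ler_norm_sum _ _ _) _; apply: ler_sum => j _.
rewrite mxE mulr_suml.
apply: le_trans (ler_norm_sum _ _ _) _; apply: ler_sum => i _.
by rewrite mxE !normrM !ler_pM ?mulr_ge0// entry_le_norm.
Qed.

Lemma bilinear_difference (G H : 'M[R]_K) (v w : vec) :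
  (v *m G *m v^T) 0 0 - (w *m H *m w^T) 0 0 =
    ((v - w) *m G *m v^T) 0 0 + (w *m (G - H) *m v^T) 0 0
    + (w *m H *m (v - w)^T) 0 0.
Proof.
have E : v *m G *m v^T - w *m H *m w^T = (v - w) *m G *m v^T
    + w *m (G - H) *m v^T + w *m H *m (v - w)^T.
  by rewrite [(v - w)^T]linearB/= !mulmxBl !mulmxBr !mulmxBl !subrKA.
by have := congr1 (fun Q : 'M[R]_1 => Q 0 0) E; rewrite !mxE.
Qed.

Lemma bilinear_lipschitz (G H : 'M[R]_K) (v w : vec) (B g l : R) :
  `|v| <= B -> `|w| <= B -> `|G| <= g -> `|H| <= g -> `|G - H| <= l ->
  `|(v *m G *m v^T) 0 0 - (w *m H *m w^T) 0 0| <=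
    K%:R ^+ 2 * (2 * (g * B) * `|v - w| + B ^+ 2 * l).
Proof.
move=> vB wB Gg Hg GHl; rewrite bilinear_difference.
have I1 := bilinear_entry_bound G (v - w) v.
have I2 := bilinear_entry_bound (G - H) w v.
have I3 := bilinear_entry_bound H w (v - w).
apply: le_trans (ler_normD _ _) _.
apply: le_trans (lerD (ler_normD _ _) (lexx _)) _.
apply: le_trans (lerD (lerD I1 I2) I3) _.
rewrite -!mulrDr; apply: ler_wpM2l; first exact: sqr_ge0.
have [[v0 w0] d0] := (normr_ge0 v, normr_ge0 w, normr_ge0 (v - w)).
have [[G0 H0] GH0] := (normr_ge0 G, normr_ge0 H, normr_ge0 (G - H)).
have J1 := ler_wpM2r v0 (ler_wpM2l d0 Gg).
have J1' := ler_wpM2l (mulr_ge0 d0 (le_trans G0 Gg)) vB.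
have J2 := ler_pM (mulr_ge0 w0 GH0) v0 (ler_pM w0 GH0 wB GHl) vB.
have J3 := ler_wpM2r d0 (ler_pM w0 H0 wB Hg).
apply: le_trans (lerD (lerD (le_trans J1 J1') J2) J3) _.
by rewrite le_eqVlt; apply/orP; left; apply/eqP; ring.
Qed.

(** [e1] and [e2] stand for the differences of the positions and of the
    velocities of two solutions. On the interval of radius [d] around [t0], the
    mean value inequality bounds the maximum of |e1| + |e2| by d (1 + A) times
    itself, that is by half of itself, so the maximum is 0. *)
Lemma local_ode_uniqueness (e1 e2 de2 : R -> vec) (t0 A : R) : 0 <= A ->
  (forall t, is_derive t (1 : R) e1 (e2 t)) ->
  (forall t, is_derive t (1 : R) e2 (de2 t)) ->
  (\forall t \near t0, `|de2 t| <= A * (`|e1 t| + `|e2 t|)) ->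
  e1 t0 = 0 -> e2 t0 = 0 ->
  \forall t \near t0, e1 t = 0 /\ e2 t = 0.
Proof.
move=> A0 d1 d2 /nbhs_ballP[r /= r0 bde] e10 e20.
pose d := Num.min (r / 2) (2^-1 / (1 + A)).
have A1 : 0 < 1 + A by rewrite ltr_pwDl.
have d0 : 0 < d by rewrite lt_min !divr_gt0.
have dr : d < r by rewrite gt_min ltr_pdivrMr// ltr_pMr// ltr1n.
have dA : d * (1 + A) <= 2^-1 by rewrite -ler_pdivlMr// ge_min lexx orbT.
pose f t := `|e1 t| + `|e2 t|.
have ce1 : continuous e1 by move=> t; exact: is_derive_continuous (d1 t).
have ce2 : continuous e2 by move=> t; exact: is_derive_continuous (d2 t).
have cf : continuous f.
  by move=> t; rewrite /continuous_at /f; apply: cvgD; apply: cvg_norm;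
    [exact: ce1|exact: ce2].
have dd : t0 - d <= t0 + d by lra.
have [s] := EVT_max dd (continuous_subspaceT cf).
have itvE t : (t \in `[t0 - d, t0 + d]%R) = (`|t - t0| <= d).
  by rewrite in_itv/= ler_distl.
rewrite itvE => sd smax; have fs0 : 0 <= f s by rewrite addr_ge0.
have fmax t : `|t - t0| <= d -> f t <= f s by rewrite -itvE; exact: smax.
have b1 : `|e1 s - e1 t0| <= f s * `|s - t0|.
  apply: (mean_value_bound_ball fs0 (fun t _ => d1 t) _ sd) => t /fmax.
  by apply: le_trans; rewrite lerDr.
have b2 : `|e2 s - e2 t0| <= (A * f s) * `|s - t0|.
  apply: (mean_value_bound_ball (mulr_ge0 A0 fs0) (fun t _ => d2 t) _ sd) => t td.
  apply: le_trans (bde t _) _.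
    by rewrite /ball/= distrC (le_lt_trans td).
  by rewrite ler_wpM2l// fmax.
have fs : f s = 0.
  move: b1 b2; rewrite e10 e20 !subr0 => b1 b2; apply/eqP; rewrite eq_le fs0 andbT.
  have : f s <= f s * (d * (1 + A)).
    apply: le_trans (lerD b1 b2) _.
    rewrite -mulrDl -[X in (X + _) * _]mul1r -mulrDl mulrAC [leRHS]mulrC.
    by rewrite ler_wpM2r// mulrC ler_wpM2r// ltW.
  have : f s * (d * (1 + A)) <= f s * 2^-1 by rewrite ler_wpM2l.
  by move=> ? ?; lra.
apply/nbhs_ballP; exists d => //= t.
rewrite /ball/= distrC => /ltW/fmax; rewrite fs => ft.
have : f t == 0 by rewrite eq_le ft addr_ge0.
by rewrite /f paddr_eq0// !normr_eq0 => /andP[/eqP -> /eqP ->].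
Qed.

Lemma clopen_nonempty_full (E : set R) (t0 : R) : E t0 -> closed E -> open E ->
  forall t, E t.
Proof.
move=> Et0 cE oE t.
suff -> : E = setT by [].
have /connected_intervalP : is_interval [set: R] by [].
apply; first by exists t0.
  by exists E => //; rewrite setTI.
by exists E => //; rewrite setTI.
Qed.

End Uniqueness.

(** * Geodesics are determined by their initial data *)

Section GeodesicUniqueness.
Variables (R : realType) (K : nat) (M : complete_manifold R K).
Local Notation vec := 'rV[R]_K.
Implicit Types (c d : R -> vec).

(** Each component of the geodesic equation is a quadratic form in the velocity
    with smooth coefficients, hence Lipschitz in position and velocity as long as
    the velocities stay bounded. *)
Lemma acceleration_lipschitz_entry c d (t0 : R) (k : 'I_K) :
  geodesic M c -> geodesic M d -> c t0 = d t0 -> derive1 c t0 = derive1 d t0 ->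
  exists A : R, 0 <= A /\ \forall t \near t0,
    `|conn M (c t) (derive1 c t) (derive1 c t) 0 k
      - conn M (d t) (derive1 d t) (derive1 d t) 0 k|
    <= A * (`|c t - d t| + `|derive1 c t - derive1 d t|).
Proof.
move=> gc gd cd0 cd1; case: (conn_levi_civita M) => -[Cs _] _ _.
have [W [G [oW Wx sG CG]]] := Cs k (c t0) (geodesicX t0 gc).
have [L [L0 [r r0 Glip]]] := smooth_locally_lipschitz oW sG Wx.
have cG : {for c t0, continuous G}.
  by apply: differentiable_continuous; case: (sG 1%N) => + _; exact.
have cc : {for t0, continuous c} := is_derive_continuous (geodesic_is_derive t0 gc).
have cd : {for t0, continuous d} := is_derive_continuous (geodesic_is_derive t0 gd).
have cc' : {for t0, continuous (derive1 c)} :=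
  is_derive_continuous (geodesic_is_derive2 t0 gc).
have cd' : {for t0, continuous (derive1 d)} :=
  is_derive_continuous (geodesic_is_derive2 t0 gd).
have nWc : \forall t \near t0, W (c t) by apply: (cc W); exact: open_nbhs_nbhs.
have nWd : \forall t \near t0, W (d t).
  by apply: (cd W); rewrite -cd0; exact: open_nbhs_nbhs.
have nrc : \forall t \near t0, `|c t0 - c t| < r.
  by move/cvgrPdist_lt : cc => /(_ _ r0).
have nrd : \forall t \near t0, `|c t0 - d t| < r.
  by rewrite cd0; move/cvgrPdist_lt : cd => /(_ _ r0).
have nBc := near_norm_bound cc'.
have nBd := near_norm_bound cd'.
have nGc : \forall t \near t0, `|(G \o c) t| <= `|(G \o c) t0| + 1.
  by apply: near_norm_bound; exact: continuous_comp.
have nGd : \forall t \near t0, `|(G \o d) t| <= `|(G \o d) t0| + 1.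
  by apply: near_norm_bound; apply: continuous_comp => //; rewrite -cd0.
have [B [B0 nvB nwB]] : exists B : R, [/\ 0 <= B,
    \forall t \near t0, `|derive1 c t| <= B &
    \forall t \near t0, `|derive1 d t| <= B].
  exists (`|derive1 c t0| + 1); split; [exact: addr_ge0|exact: nBc|].
  exact: (eq_ind_r (fun v => \forall t \near t0, `|derive1 d t| <= `|v| + 1) nBd cd1).
have [g [g0 nGc' nGd']] : exists g : R, [/\ 0 <= g,
    \forall t \near t0, `|G (c t)| <= g & \forall t \near t0, `|G (d t)| <= g].
  exists (`|G (c t0)| + 1); split; [exact: addr_ge0|exact: nGc|].
  exact: (eq_ind_r (fun x => \forall t \near t0, `|G (d t)| <= `|G x| + 1) nGd cd0).
exists (K%:R ^+ 2 * (2 * (g * B) + B ^+ 2 * L)); split.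
  by rewrite mulr_ge0 ?sqr_ge0// addr_ge0 ?mulr_ge0 ?sqr_ge0.
have nvw := filterI nvB nwB; clear nvB nwB nBc nBd.
near=> t.
have [vB wB] : `|derive1 c t| <= B /\ `|derive1 d t| <= B by near: t; exact: nvw.
rewrite CG; last 4 first.
- exact: geodesicX.
- by near: t; exact: nWc.
- exact: geodesic_tangent.
- exact: geodesic_tangent.
rewrite CG; last 4 first.
- exact: geodesicX.
- by near: t; exact: nWd.
- exact: geodesic_tangent.
- exact: geodesic_tangent.
apply: (@le_trans _ _ (K%:R ^+ 2 * (2 * (g * B) * `|derive1 c t - derive1 d t|
    + B ^+ 2 * (L * `|c t - d t|)))).
  apply: bilinear_lipschitz.
  - exact: vB.
  - exact: wB.
  - by near: t; exact: nGc'.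
  - by near: t; exact: nGd'.
  - by apply: Glip; [near: t; exact: nrc|near: t; exact: nrd].
rewrite -[leRHS]mulrA; apply: ler_wpM2l; first exact: sqr_ge0.
have := normr_ge0 (c t - d t); have := normr_ge0 (derive1 c t - derive1 d t).
move: (`|c t - d t|) (`|derive1 c t - derive1 d t|) => y x x0 y0.
have gBy : 0 <= g * B * y by rewrite !mulr_ge0.
have BLx : 0 <= B ^+ 2 * L * x by rewrite !mulr_ge0 ?sqr_ge0.
by lra.
Unshelve. all: by end_near. Qed.

Lemma acceleration_lipschitz c d (t0 : R) :
  geodesic M c -> geodesic M d -> c t0 = d t0 -> derive1 c t0 = derive1 d t0 ->
  exists A : R, 0 <= A /\ \forall t \near t0,
    `|derive1 (derive1 c) t - derive1 (derive1 d) t|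
    <= A * (`|c t - d t| + `|derive1 c t - derive1 d t|).
Proof.
move=> gc gd cd0 cd1.
have /choice[A AP] := fun k => acceleration_lipschitz_entry k gc gd cd0 cd1.
have A0 : 0 <= \sum_k A k by apply: sumr_ge0 => k _; case: (AP k).
exists (\sum_k A k); split=> //.
have nA := @filter_forall _ _ _ (nbhs t0) (nbhs_filter t0) (fun k => (AP k).2).
near=> t.
have accel e : geodesic M e ->
    derive1 (derive1 e) t = - conn M (e t) (derive1 e t) (derive1 e t).
  by move=> [_ /(_ t)[_ /eqP]]; rewrite addr_eq0 => /eqP.
have f0 : 0 <= `|c t - d t| + `|derive1 c t - derive1 d t| by rewrite addr_ge0.
apply: norm_le_entries => [|i k]; first by rewrite mulr_ge0.
rewrite (ord1 i) !accel// !mxE -opprD normrN.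
have : forall k, `|conn M (c t) (derive1 c t) (derive1 c t) 0 k
      - conn M (d t) (derive1 d t) (derive1 d t) 0 k|
    <= A k * (`|c t - d t| + `|derive1 c t - derive1 d t|) by near: t.
move=> /(_ k)/le_trans; apply; rewrite ler_wpM2r//.
by rewrite (bigD1 k)//= lerDl sumr_ge0// => j _; case: (AP j).
Unshelve. all: by end_near. Qed.

(** The set of times where the positions and the velocities agree is closed by
    continuity, open by local uniqueness, and contains [t0]. *)
Theorem geodesic_unique c d (t0 : R) :
  geodesic M c -> geodesic M d -> c t0 = d t0 -> derive1 c t0 = derive1 d t0 ->
  forall t, c t = d t.
Proof.
move=> gc gd cd0 cd1.
pose e1 t := c t - d t; pose e2 t := derive1 c t - derive1 d t.
have de1 t : is_derive t (1 : R) e1 (e2 t).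
  exact: (is_deriveB (geodesic_is_derive t gc) (geodesic_is_derive t gd)).
have de2 t : is_derive t (1 : R) e2
    (derive1 (derive1 c) t - derive1 (derive1 d) t).
  exact: (is_deriveB (geodesic_is_derive2 t gc) (geodesic_is_derive2 t gd)).
have ce1 : continuous e1 by move=> t; exact: is_derive_continuous (de1 t).
have ce2 : continuous e2 by move=> t; exact: is_derive_continuous (de2 t).
pose E : set R := [set t | `|e1 t| + `|e2 t| = 0].
have EP t : E t <-> e1 t = 0 /\ e2 t = 0.
  split=> [/eqP|[e10 e20]]; last by rewrite /E/= e10 e20 !normr0 addr0.
  by rewrite paddr_eq0// !normr_eq0 => /andP[/eqP -> /eqP ->].
have Et : forall t, E t.
  apply: (@clopen_nonempty_full _ _ t0).
  - by apply/EP; rewrite /e1 /e2 cd0 cd1 !subrr.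
  - apply: (@preimage_closed _ _ (fun t => `|e1 t| + `|e2 t|) [set x | x = 0]).
      move=> t _; rewrite /continuous_at; apply: cvgD; apply: cvg_norm.
        exact: ce1.
      exact: ce2.
    exact: closed_eq.
  - rewrite openE => t /EP[/eqP + /eqP]; rewrite !subr_eq0 => /eqP e10 /eqP e20.
    have [A [A0 nA]] := acceleration_lipschitz gc gd e10 e20.
    have := local_ode_uniqueness A0 de1 de2 nA.
    rewrite /e1 /e2 e10 e20 !subrr => /(_ erefl erefl).
    by apply: filterS => s /EP.
move=> t; have /EP[/eqP + _] := Et t.
by rewrite subr_eq0 => /eqP.
Qed.

End GeodesicUniqueness.

(** * Aligned triples of points *)

Section Aligned.
Variables (R : realType) (K : nat) (M : complete_manifold R K).
Local Notation vec := 'rV[R]_K.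
Local Notation X := (carrier M).
Implicit Types (c : R -> vec) (x y z : vec).

(** Minimizing geodesics from [x] to [y] and from [y] to [z] that continue each
    other. It is symmetric in [x] and [z]. A local geodesic provides such triples,
    and the vanishing of [Dpt M y z x y] expresses alignment when the minimizing
    geodesic from [x] to [y] is unique. *)
Definition aligned x y z : Prop :=
  exists c1 c2, [/\ min_geodesic M c1 x y, min_geodesic M c2 y z
    & derive1 c1 1 = derive1 c2 0].

Lemma min_geodesic_carrier c x y : min_geodesic M c x y -> X x /\ X y.
Proof. by move=> [cg <- <- _]; split; exact: geodesicX. Qed.

Lemma reversed_parallel c :
  geodesic M c -> parallel M (reversed c) (reversed (derive1 c)).
Proof.
move=> cg; have rg := geodesic_reversed cg; have rp := geodesic_parallel rg.
have := parallel_lin (-2) (rg.1) rp rp; congr parallel.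
apply/funext => t; rewrite (derive1_reversed cg) scalerN scaleNr opprK.
by rewrite mulr2n scalerDl scale1r addrK.
Qed.

Lemma aligned_sym x y z : aligned x y z -> aligned z y x.
Proof.
move=> [c1 [c2 [m1 m2 c12]]]; exists (reversed c2), (reversed c1).
have [g1 _ _ _] := m1; have [g2 _ _ _] := m2.
split; [exact: min_geodesic_reversed|exact: min_geodesic_reversed|].
by rewrite (derive1_reversed g2) (derive1_reversed g1) reversed0 reversed1 c12.
Qed.

Lemma aligned_Dpt x y z : aligned x y z -> Dpt M y z x y 0.
Proof.
move=> [c1 [c2 [m1 m2 c12]]]; have [g1 _ _ _] := m1.
have [_ Xy] := min_geodesic_carrier m1.
split; last by move=> _ [z1 [z2 [w [_ _ _ ->]]]]; exact: tnorm_ge0.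
exists (derive1 c2 0), (derive1 c1 1), (derive1 c1 0); split.
- by exists c2.
- by exists c1.
- by exists c1, (derive1 c1); split; [exact: m1|exact: geodesic_parallel| |].
- by rewrite c12 subrr tnorm0.
Qed.

(** Along the reversed geodesic from [y] to [x], the velocity at [y] is
    transported to the velocity at [x], whose exponential is [y] again. *)
Lemma aligned_transport_back x y z : aligned x y z ->
  exists w1 z1, [/\ logm M y z w1, ptm M y x w1 z1 & expm M x z1 y].
Proof.
move=> [c1 [c2 [m1 m2 c12]]]; have [g1 c10 c11 _] := m1.
exists (derive1 c2 0), (derive1 c1 0); split; first by exists c2.
- exists (reversed c1), (reversed (derive1 c1)); split.
  + exact: min_geodesic_reversed.
  + exact: reversed_parallel.
  + by rewrite reversed0.
  + by rewrite reversed1.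
- by exists c1.
Qed.

(** If the row and the column through [u] are aligned, [r1] and [r2] can both be
    taken equal to [u], and what remains is [Dpt] on the antidiagonal. *)
Lemma aligned_Dptsym u b b' e f g h :
  aligned g u b -> aligned e u b' -> aligned f u h ->
  Dptsym M u b u b' e f g h 0.
Proof.
move=> gub eub fuh; split; last first.
  by move=> _ [r1 [r2 [_ _ [[z1 [z2 [w [_ _ _ ->]]]] _]]]]; exact: tnorm_ge0.
exists u, u; split; [|exact: aligned_transport_back|exact: aligned_Dpt].
exact: aligned_transport_back gub.
Qed.

(** Uniqueness is assumed on [0, 1] only. The two curves then have the same
    position and velocity at the interior time 1/2, hence agree at all times. *)
Lemma unique_min_geodesic_eq x y c d : unique_min_geodesic M x y ->
  min_geodesic M c x y -> min_geodesic M d x y -> c = d.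
Proof.
move=> [c0 _ c0P] mc md; have cd t : 0 <= t <= 1 -> c t = d t.
  by move=> t01; rewrite (c0P c)// (c0P d).
have h01 : 0 <= (2^-1 : R) <= 1 by apply/andP; split; lra.
have ncd : \forall t \near (2^-1 : R), c t = d t.
  near=> t; apply: cd; apply/andP; split.
    by apply/ltW; near: t; apply: lt_nbhsr; lra.
  by apply/ltW; near: t; apply: lt_nbhsl; lra.
apply/funext; have [gc _ _ _] := mc; have [gd _ _ _] := md.
apply: (geodesic_unique gc gd (t0 := 2^-1)); first exact: cd.
by rewrite !derive1E; exact: near_eq_derive.
Unshelve. all: by end_near. Qed.

(** Along the unique minimizing geodesic from [x] to [y], the initial velocity is
    transported to the final velocity. *)
Lemma Dpt0_aligned x y z : unique_min_geodesic M x y ->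
  Dpt M y z x y 0 -> aligned x y z.
Proof.
move=> uxy [[z1 [z2 [w [[c2 [m2 <-]] [c1 [m1 <-]] [c [V [m pV V0 ->]]] z12]]]] _].
have E := unique_min_geodesic_eq uxy m1 m; subst c1; have [gc _ c1 _] := m.
have VE := parallel_unique (proj1 gc) pV (geodesic_parallel gc) V0.
exists c, c2; split; [exact: m|exact: m2|]; have [g2 c20 _ _] := m2.
have Xy : X y by rewrite -c1; exact: geodesicX.
apply/esym/eqP; rewrite -subr_eq0; apply/eqP/(tnorm_eq0 Xy); last by rewrite -VE.
apply: tangentB => //; [rewrite -c20|rewrite -c1]; exact: geodesic_tangent.
Qed.

(** By uniqueness of all the minimizing geodesics, the transported vector can
    only be the initial velocity of the geodesic from [x] to [y]; the geodesic
    with this initial velocity passes through [y] because geodesics are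
    determined by their initial data. *)
Lemma transport_back_unique x y z w1 z1 r : aligned x y z ->
  unique_min_geodesic M y z -> unique_min_geodesic M y x ->
  logm M y z w1 -> ptm M y x w1 z1 -> expm M x z1 r -> r = y.
Proof.
move=> [c1 [c2 [m1 m2 c12]]] uyz uyx [d [md <-]] [c [V [m pV V0 ->]]].
move=> [e [ge e0 e1 ->]].
have E := unique_min_geodesic_eq uyz md m2; subst d.
have E := unique_min_geodesic_eq uyx m (min_geodesic_reversed m1); subst c.
have [g1 c10 c11 _] := m1.
have V0' : V 0 = reversed (derive1 c1) 0 by rewrite V0 reversed0.
have VE := parallel_unique (proj1 (geodesic_reversed g1)) pV (reversed_parallel g1) V0'.
rewrite -c11; apply: (geodesic_unique ge g1 (t0 := 0)); first by rewrite c10.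
by rewrite e1 VE reversed1.
Qed.

Lemma Dptsym0_aligned u b b' e f g h :
  aligned g u b -> aligned e u b' ->
  unique_min_geodesic M u b -> unique_min_geodesic M u b' ->
  unique_min_geodesic M u g -> unique_min_geodesic M u e ->
  unique_min_geodesic M f u ->
  Dptsym M u b u b' e f g h 0 -> aligned f u h.
Proof.
move=> gub eub ub ub' ug ue fu [[r1 [r2 [[w1 [z1 [l1 p1 e1]]]]]] ].
move=> [w2 [z2 [l2 p2 e2]]] D _; apply: Dpt0_aligned => //.
by rewrite -{1}(transport_back_unique gub ub ug l1 p1 e1)
  -(transport_back_unique eub ub' ue l2 p2 e2).
Qed.

Lemma aligned_cst x : X x -> aligned x x x.
Proof.
move=> Xx; exists (fun=> x), (fun=> x); rewrite !derive1_cst.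
have m : min_geodesic M (fun=> x) x x.
  apply/min_geodesicP; split=> //; first exact: geodesic_cst.
  by rewrite derive1_cst tnorm0// rdistxx.
by split.
Qed.

Lemma geodesic_seq_aligned (v : nat -> vec) :
  X (v 0%N) -> X (v 1%N) -> X (v 2) -> geodesic_seq M 2 v ->
  aligned (v 0%N) (v 1%N) (v 2).
Proof.
move=> X0 X1 X2 [L [c [L0 cg cv dv]]].
have [L00|Lneq0] := eqVneq L 0.
  have := dv 0%N isT; have := dv 1%N isT; rewrite L00 mul0r.
  move=> /(rdist_eq0 X1 X2) <- /(rdist_eq0 X0 X1) <-; exact: aligned_cst.
have {}L0 : 0 < L by rewrite lt0r Lneq0.
have [gc c1] := cg L0; pose a := L / 2.
have a0 : 0 < a by rewrite divr_gt0.
have cv0 : c 0 = v 0%N by rewrite -(cv 0%N)// !mul0r.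
have cv1 : c a = v 1%N by rewrite -(cv 1%N)// mulr1n mul1r.
have cv2 : c (a + a) = v 2.
  by rewrite -(cv 2)//; congr c; rewrite /a; field.
have G b : geodesic M (fun t => c (a * t + b)) by exact: geodesic_affine.
have S b : tnorm M (c b) (derive1 (fun t => c (a * t + b)) 0) = a.
  rewrite (geodesic_derive1_affine _ _ gc) mulr0 add0r tnormZ ?c1 ?mulr1 ?gtr0_norm//.
    exact: geodesicX.
  exact: geodesic_tangent.
exists (fun t => c (a * t + 0)), (fun t => c (a * t + a)); split.
- apply/min_geodesicP; split; [exact: G|by rewrite mulr0 addr0|
    by rewrite mulr1 addr0|].
  by rewrite -[in tnorm _ _]cv0 S (dv 0%N).
- apply/min_geodesicP; split; [exact: G|by rewrite mulr0 add0r|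
    by rewrite mulr1|].
  by rewrite -[in tnorm _ _]cv1 S (dv 1%N).
- by rewrite !(geodesic_derive1_affine _ _ gc) mulr0 add0r mulr1 addr0.
Qed.

(** Uniqueness identifies the geodesic that aligns [v n] with its successor with
    the end of the geodesic already built, so the next piece can be spliced to
    it. *)
Lemma aligned_chain (n : nat) (v : nat -> vec) :
  X (v 0%N) -> X (v 1%N) ->
  (forall i, (i < n)%N -> aligned (v i) (v i.+1) (v i.+2)) ->
  (forall i, (i < n)%N -> unique_min_geodesic M (v i) (v i.+1)) ->
  exists2 c, geodesic M c & forall k, (k <= n)%N ->
    min_geodesic M (fun t => c (1 * t + k%:R)) (v k) (v k.+1).
Proof.
move=> X0 X1; elim: n => [_ _|n IH al un].
  have [c mc] := min_geodesic_exists X0 X1; have [cg _ _ _] := mc.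
  exists c; first exact: cg.
  move=> k; rewrite leqn0 => /eqP ->.
  have -> : (fun t => c (1 * t + 0%:R)) = c.
    by apply/funext => t; rewrite mul1r addr0.
  exact: mc.
have [i iltn|i iltn|c cg cmin] := IH.
- by apply: al; exact: ltnW.
- by apply: un; exact: ltnW.
have [c1 [c2 [m1 m2 c12]]] := al n (ltnSn n).
have := unique_min_geodesic_eq (un n (ltnSn n)) m1 (cmin n (leqnn n)) => E.
subst c1; have [g2 c20 c21 _] := m2; pose x : R := n.+1%:R.
pose d := fun t : R => c2 (1 * t + - x).
have dg : geodesic M d by exact: geodesic_affine.
have nx : 1 * 1 + n%:R = x by rewrite mulr1 addrC natr1.
have cdx : c x = d x.
  by have [_ _ + _] := m1; rewrite nx => ->; rewrite /d mul1r subrr.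
have cdx' : derive1 c x = derive1 d x.
  move: c12; rewrite (geodesic_derive1_affine _ _ cg) nx scale1r => ->.
  by rewrite (geodesic_derive1_affine _ _ g2) mul1r subrr scale1r.
have [sg sd] := geodesic_splice cg dg cdx cdx'.
exists (splice x c d); first exact: sg.
move=> k; rewrite leq_eqVlt ltnS => /predU1P[->|kn].
  apply/min_geodesicP; split.
  - exact: geodesic_affine.
  - by rewrite mulr0 add0r spliceL// cdx /d mul1r subrr.
  - rewrite mulr1 spliceR ?ltrDr//.
    by rewrite /d mul1r addrK.
  - rewrite (geodesic_derive1_affine _ _ sg) scale1r mulr0 add0r sd spliceL// cdx'.
    rewrite (geodesic_derive1_affine _ _ g2) mul1r subrr scale1r.
    by have /min_geodesicP[] := m2.
have /min_geodesicP[_ ck ck1 cks] := cmin k kn.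
have kx : k%:R <= x by rewrite ler_nat leqW.
apply/min_geodesicP; split.
- exact: geodesic_affine.
- by rewrite spliceL ?mulr0 ?add0r//; rewrite mulr0 add0r in ck.
- by rewrite spliceL// mulr1 addrC natr1 ler_nat.
- rewrite -cks (geodesic_derive1_affine _ _ sg) (geodesic_derive1_affine _ _ cg).
  by rewrite sd mulr0 add0r spliceL.
Qed.

(** A chain has constant speed [s], the common distance of consecutive points;
    it only remains to reparametrize it to unit speed, unless [s] is 0. *)
Lemma aligned_geodesic_seq (n : nat) (v : nat -> vec) :
  (forall i, (i <= n)%N -> X (v i)) ->
  (forall i, (i.+2 <= n)%N -> aligned (v i) (v i.+1) (v i.+2)) ->
  (forall i, (i.+1 <= n)%N -> unique_min_geodesic M (v i) (v i.+1)) ->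
  geodesic_seq M n v.
Proof.
case: n => [_ _ _|n Xv al un].
  by exists 0, (fun=> v 0%N); split=> // [|i]; [rewrite ltxx|rewrite leqn0 => /eqP ->].
have [i iltn|c cg cmin] := aligned_chain (Xv 0%N isT) (Xv 1%N isT) al.
  by apply: un; exact: ltnW.
pose s := tnorm M (c 0) (derive1 c 0).
have cv k : (k <= n.+1)%N -> c k%:R = v k.
  case: k => [|k] kn; last first.
    by have [_ _ <- _] := cmin k kn; rewrite mulr1 addrC natr1.
  by have [_ <- _ _] := cmin 0%N isT; rewrite mulr0 add0r.
have dv k : (k < n.+1)%N -> rdist M (v k) (v k.+1) = s.
  move=> kn; have /min_geodesicP[_ ck _ <-] := cmin k kn.
  rewrite -ck (geodesic_derive1_affine _ _ cg) mulr0 add0r scale1r.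
  exact: geodesic_speed.
have [s0|sneq0] := eqVneq s 0.
  exists 0, (fun=> c 0); split; [exact: lexx|by rewrite ltxx| |].
    move=> k kn; rewrite -cv//; apply/esym/(rest_geodesic cg).
    exact: tnorm_eq0 (geodesicX 0 cg) (geodesic_tangent 0 cg) s0.
  by move=> k kn; rewrite dv// s0 mul0r.
have s_gt0 : 0 < s by rewrite lt0r sneq0 tnorm_ge0.
have nLn : n.+1%:R != 0 :> R by rewrite pnatr_eq0.
exists (n.+1%:R * s), (fun t => c (s^-1 * t + 0)); split.
- by rewrite mulr_ge0// ltW.
- move=> _; split=> [|t]; first exact: geodesic_affine.
  rewrite (geodesic_derive1_affine _ _ cg) tnormZ; last 2 first.
  + exact: geodesicX.
  + exact: geodesic_tangent.
  rewrite (geodesic_speed _ 0 cg) -/s gtr0_norm ?invr_gt0// mulVf//.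
- move=> k kn; rewrite -cv//; congr c; rewrite addr0.
  move: (n.+1%:R : R) nLn => N N0.
  by field; rewrite sneq0 N0.
- by move=> k kn; rewrite dv// mulrAC divff// mul1r.
Qed.

End Aligned.

(** * Minima as sets of values *)

Section Minimum.
Variable R : realType.

Lemma minimum_unique (S : set R) a b : minimum S a -> minimum S b -> a = b.
Proof. by move=> [Sa la] [Sb lb]; apply/eqP; rewrite eq_le la ?lb. Qed.

Lemma minimum_set1 (S : set R) m : minimum S m -> minimum S = [set m].
Proof.
by move=> Sm; apply/seteqP; split=> [a Sa|_ ->//]; exact: minimum_unique Sa Sm.
Qed.

End Minimum.

(** * Sums over the grid *)

Section GridSums.
Variables (R : realType) (p : R) (N1 N2 : nat).
Implicit Types A B F G : nat -> nat -> R.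

Lemma eq_grid_sum F G :
  (forall i j, in_u N1 N2 i j -> F i j = G i j) ->
  grid_sum N1 N2 F = grid_sum N1 N2 G.
Proof.
move=> FG; apply: eq_big_nat => i iN; apply: eq_big_nat => j jN.
by apply: FG; rewrite /in_u; lia.
Qed.

Lemma grid_sum_ge0 F : (forall i j, 0 <= F i j) -> 0 <= grid_sum N1 N2 F.
Proof. by move=> F0; apply: sumr_ge0 => i _; exact: sumr_ge0. Qed.

Lemma grid_sum0 : grid_sum N1 N2 (fun _ _ => 0 : R) = 0.
Proof. by rewrite /grid_sum big1// => i _; rewrite big1. Qed.

Lemma grid_sum_ge_term (F : nat -> nat -> R) i j :
  (forall i j, 0 <= F i j) -> in_u N1 N2 i j -> F i j <= grid_sum N1 N2 F.
Proof.
move=> F0 ij; rewrite /grid_sum.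
have iN : i \in index_iota 1 N1.+1 by move: ij; rewrite /in_u mem_index_iota; lia.
have jN : j \in index_iota 1 N2.+1 by move: ij; rewrite /in_u mem_index_iota; lia.
rewrite (big_rem i)//= (big_rem j)//= -addrA lerDl addr_ge0//; apply: sumr_ge0 => //.
by move=> k _; exact: sumr_ge0.
Qed.

Lemma grid_sum_eq0 F : (forall i j, 0 <= F i j) -> grid_sum N1 N2 F = 0 ->
  forall i j, in_u N1 N2 i j -> F i j = 0.
Proof.
move=> F0 S0 i j ij; apply/eqP; rewrite eq_le F0 andbT -S0.
exact: grid_sum_ge_term.
Qed.

Lemma sum2_ge0 A1 A2 : 0 <= sum2 p N1 N2 A1 A2.
Proof. by apply: grid_sum_ge0 => i j; exact: powR_ge0. Qed.

Lemma sum3_ge0 B1 B2 B3 : 0 <= sum3 p N1 N2 B1 B2 B3.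
Proof. by apply: grid_sum_ge0 => i j; exact: powR_ge0. Qed.

Lemma eq_sum2 A1 A2 A1' A2' :
  (forall i j, in_u N1 N2 i j -> A1 i j = A1' i j /\ A2 i j = A2' i j) ->
  sum2 p N1 N2 A1 A2 = sum2 p N1 N2 A1' A2'.
Proof. by move=> AA; apply: eq_grid_sum => i j /AA[-> ->]. Qed.

Lemma eq_sum3 B1 B2 B3 B1' B2' B3' :
  (forall i j, in_u N1 N2 i j ->
    [/\ B1 i j = B1' i j, B2 i j = B2' i j & B3 i j = B3' i j]) ->
  sum3 p N1 N2 B1 B2 B3 = sum3 p N1 N2 B1' B2' B3'.
Proof. by move=> BB; apply: eq_grid_sum => i j /BB[-> -> ->]. Qed.

Hypothesis p0 : p != 0.

Lemma sum2_0 : sum2 p N1 N2 (fun _ _ => 0) (fun _ _ => 0) = 0.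
Proof. by rewrite /sum2 /= powR0// addr0 powR0 ?invr_eq0// grid_sum0. Qed.

Lemma sum3_0 : sum3 p N1 N2 (fun _ _ => 0) (fun _ _ => 0) (fun _ _ => 0) = 0.
Proof. by rewrite /sum3 /= powR0// mulr0 !addr0 powR0 ?invr_eq0// grid_sum0. Qed.

Lemma sum2_eq0 A1 A2 : sum2 p N1 N2 A1 A2 = 0 ->
  forall i j, in_u N1 N2 i j -> A1 i j = 0 /\ A2 i j = 0.
Proof.
move=> /grid_sum_eq0 A0 i j /A0 => /(_ (fun _ _ => powR_ge0 _ _))/powR_eq0_eq0/eqP.
rewrite paddr_eq0 ?powR_ge0// => /andP[/eqP + /eqP].
by move=> /powR_eq0_eq0 -> /powR_eq0_eq0 ->.
Qed.

Lemma sum3_eq0 B1 B2 B3 : sum3 p N1 N2 B1 B2 B3 = 0 ->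
  forall i j, in_u N1 N2 i j -> [/\ B1 i j = 0, B2 i j = 0 & B3 i j = 0].
Proof.
move=> /grid_sum_eq0 A0 i j /A0 => /(_ (fun _ _ => powR_ge0 _ _))/powR_eq0_eq0/eqP.
have q0 : 0 < (2 : R) `^ (1 - p) by exact: powR_gt0.
rewrite paddr_eq0 ?addr_ge0 ?mulr_ge0 ?powR_ge0//.
rewrite paddr_eq0 ?powR_ge0// mulf_eq0 (gt_eqF q0)/=.
move=> /andP[/andP[/eqP + /eqP] + /eqP].
by move=> /powR_eq0_eq0 -> /powR_eq0_eq0 -> /powR_eq0_eq0 ->.
Qed.

End GridSums.

(** * The functional on manifold-valued signals *)

Section Functional.
Variables (R : realType) (K : nat) (M : complete_manifold R K).
Variables (p : R) (N1 N2 : nat).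
Hypothesis p_ge1 : 1 <= p.
Local Notation vec := 'rV[R]_K.
Local Notation X := (carrier M).
Local Notation signal := (nat -> nat -> vec).
Implicit Types (u : signal) (x y z : vec) (r : R).

Let p0 : p != 0.
Proof. by rewrite gt_eqF// (lt_le_trans ltr01). Qed.

Lemma PTTGV_cost_ge0 (alpha0 alpha1 : R) u (y1 y2 : signal) r :
  0 <= alpha0 -> 0 <= alpha1 ->
  PTTGV_cost M p N1 N2 alpha0 alpha1 u y1 y2 r -> 0 <= r.
Proof.
move=> a0 a1 [B1 [B2 [B3 [_ ->]]]].
by rewrite addr_ge0// mulr_ge0// ?sum2_ge0 ?sum3_ge0.
Qed.

Lemma guard_set_minimum_unique b (S : set R) r r' :
  guard_set b (minimum S) r -> guard_set b (minimum S) r' -> r = r'.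
Proof. by case: b => /=; [exact: minimum_unique|move=> -> ->]. Qed.

Lemma PTTGV_cost_unique (alpha0 alpha1 : R) u (y1 y2 : signal) r r' :
  PTTGV_cost M p N1 N2 alpha0 alpha1 u y1 y2 r ->
  PTTGV_cost M p N1 N2 alpha0 alpha1 u y1 y2 r' -> r = r'.
Proof.
move=> [B1 [B2 [B3 [HB ->]]]] [B1' [B2' [B3' [HB' ->]]]].
refine (congr1 (fun s => _ + alpha0 * s) _); apply: eq_sum3 => i j _.
have [b1 b2 b3] := HB i j; have [b1' b2' b3'] := HB' i j.
by split; [move: b1 b1'|move: b2 b2'|move: b3 b3'];
  exact: guard_set_minimum_unique.
Qed.

(** * The zero vector field *)

(** A minimizing geodesic from [x] to [x] has speed d(x, x) = 0. *)
Lemma logm_refl x z : logm M x x z -> z = 0 /\ X x.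
Proof.
move=> [c [mc <-]]; have [Xx _] := min_geodesic_carrier mc.
have /min_geodesicP[gc c0 _] := mc; rewrite rdistxx// => z0; split=> //.
by apply: (tnorm_eq0 Xx) => //; rewrite -{1}c0; exact: geodesic_tangent.
Qed.

Lemma ptm0 x y z : ptm M x y 0 z -> z = 0.
Proof.
move=> [c [V [[gc _ _ _] pV V0 ->]]]; have [cX _] := gc.
apply: (@tnorm_eq0 _ _ M (c 1)); first exact: geodesicX.
  by case: pV => /(_ 1)[].
by rewrite (parallel_tnorm cX pV 1 0) V0 tnorm0//; exact: geodesicX.
Qed.

Lemma expm0 x y : expm M x 0 y -> y = x.
Proof. by move=> [c [gc <- c0 ->]]; exact: (rest_geodesic gc). Qed.

Lemma Dpt_refl x y r : Dpt M x x y y r -> r = 0.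
Proof.
move=> [[z1 [z2 [w [/logm_refl[-> Xx] /logm_refl[-> _] /ptm0 -> ->]]]] _].
by rewrite subrr tnorm0.
Qed.

Lemma Dptsym_refl x y z r : Dptsym M x x x x y y z z r -> r = 0.
Proof.
move=> [[r1 [r2 [[w1 [z1 [l1 t1 e1]]] [w2 [z2 [l2 t2 e2]]] D]]] _].
have [w10 _] := logm_refl l1; have [w20 _] := logm_refl l2; subst w1 w2.
have z10 := ptm0 t1; have z20 := ptm0 t2; subst z1 z2.
by move: D; rewrite (expm0 e1) (expm0 e2); exact: Dpt_refl.
Qed.

Lemma PTTGV_zero_field (alpha0 alpha1 : R) u :
  attained_at M p N1 N2 alpha0 alpha1 u u u ->
  PTTGV M p N1 N2 alpha0 alpha1 u =
    [set alpha1 * sum2 p N1 N2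
      (fun i j => guard (in_u N1 N2 i.+1 j && in_u N1 N2 i j)
         (rdist M (u i.+1 j) (u i j)))
      (fun i j => guard (in_u N1 N2 i j.+1 && in_u N1 N2 i j)
         (rdist M (u i j.+1) (u i j)))].
Proof.
move=> [r [B1 [B2 [B3 [HB ->]]]] rmin]; rewrite /PTTGV (minimum_set1 rmin).
have B0 i j : [/\ B1 i j = 0, B2 i j = 0 & B3 i j = 0].
  have [] := HB i j; rewrite /guard_set.
  move=> b1 b2 b3; split.
  - by move: b1; case: ifP => _; [exact: Dpt_refl|].
  - by move: b2; case: ifP => _; [exact: Dpt_refl|].
  - by move: b3; case: ifP => _; [exact: Dptsym_refl|].
have -> : sum3 p N1 N2 B1 B2 B3 = 0.
  by rewrite -(sum3_0 N1 N2 p0); apply: eq_sum3 => i j _; exact: B0.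
rewrite mulr0 addr0; refine (congr1 (fun s => [set alpha1 * s]) _).
apply: eq_sum2 => i j ij.
have -> : in_u N1 N2 i.+1 j && in_u N1 N2 i j = in_1 N1 N2 i j.
  by move: ij; rewrite /in_u /in_1; lia.
have -> : in_u N1 N2 i j.+1 && in_u N1 N2 i j = in_2 N1 N2 i j.
  by move: ij; rewrite /in_u /in_2; lia.
by [].
Qed.

(** * Geodesic signals *)

Definition row_aligned u := forall i j, in_D1 N1 N2 i j ->
  aligned M (u i.-1 j) (u i j) (u i.+1 j).
Definition column_aligned u := forall i j, in_D2 N1 N2 i j ->
  aligned M (u i j.-1) (u i j) (u i j.+1).
Definition antidiagonal_aligned u := forall i j, in_D3 N1 N2 i j ->
  aligned M (u i.+1 j.-1) (u i j) (u i.-1 j.+1).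

Lemma locally_geodesic_aligned u : signal_in M (in_u N1 N2) u ->
  locally_geodesic_signal M N1 N2 u ->
  [/\ row_aligned u, column_aligned u & antidiagonal_aligned u].
Proof.
move=> Xu lg; split=> i j ij.
- have [//|+ _ _] := lg i j; first by move: ij; rewrite /in_D1 /in_1 /in_u; lia.
  move=> /(_ i.-1); case: i ij => [|[|i]] ij; try by move: ij; rewrite /in_D1 /in_1; lia.
  have iN : (1 <= i.+1 < N1.-1)%N by move: ij; rewrite /in_D1 /in_1; lia.
  move=> /(_ iN) /geodesic_seq_aligned; rewrite addn0 addn1 addn2.
  by apply; apply: Xu; move: ij; rewrite /in_D1 /in_1 /in_u; lia.
- have [//|_ + _] := lg i j; first by move: ij; rewrite /in_D2 /in_2 /in_u; lia.
  move=> /(_ j.-1); case: j ij => [|[|j]] ij; try by move: ij; rewrite /in_D2 /in_2; lia.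
  have jN : (1 <= j.+1 < N2.-1)%N by move: ij; rewrite /in_D2 /in_2; lia.
  move=> /(_ jN) /geodesic_seq_aligned; rewrite addn0 addn1 addn2.
  by apply; apply: Xu; move: ij; rewrite /in_D2 /in_2 /in_u; lia.
(* Antidiagonals are enumerated with increasing [i], from [u i.-1 j.+1]. *)
- apply: aligned_sym.
  have [//|_ _] := lg i j; first by move: ij; rewrite /in_D3 /in_1 /in_2 /in_u; lia.
  set a := minn _ _; set b := minn _ _ => /(_ a).
  have ab : (1 <= a < a + b)%N.
    by move: ij; rewrite /a /b /in_D3 /in_1 /in_2; lia.
  move=> /(_ ab) /geodesic_seq_aligned.
  have a1 : (a <= i.-1)%N by rewrite /a; lia.
  have -> : (i - a + (a.-1 + 0))%N = i.-1 by lia.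
  have -> : (j + a - (a.-1 + 0))%N = j.+1 by lia.
  have -> : (i - a + (a.-1 + 1))%N = i by lia.
  have -> : (j + a - (a.-1 + 1))%N = j by lia.
  have -> : (i - a + (a.-1 + 2))%N = i.+1 by lia.
  have -> : (j + a - (a.-1 + 2))%N = j.-1 by lia.
  by apply; apply: Xu; move: ij; rewrite /in_D3 /in_1 /in_2 /in_u; lia.
Qed.

Lemma aligned_geodesic_signal u : signal_in M (in_u N1 N2) u ->
  near_unique_geodesics M N1 N2 u ->
  row_aligned u -> column_aligned u -> antidiagonal_aligned u ->
  geodesic_signal M N1 N2 u.
Proof.
move=> Xu un ru cu du i j ij; split.
- apply: aligned_geodesic_seq => k kn.
  + by apply: Xu; move: ij; rewrite /in_u; lia.
  + by apply: (ru k.+2 j); move: ij; rewrite /in_u /in_D1 /in_1; lia.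
  + by apply: un; move: ij; rewrite /in_u; lia.
- apply: aligned_geodesic_seq => k kn.
  + by apply: Xu; move: ij; rewrite /in_u; lia.
  + by apply: (cu i k.+2); move: ij; rewrite /in_u /in_D2 /in_2; lia.
  + by apply: un; move: ij; rewrite /in_u; lia.
- set a := minn _ _; set b := minn _ _.
  have a1 : (a <= i - 1)%N by rewrite /a; lia.
  have a2 : (a <= N2 - j)%N by rewrite /a; lia.
  have b1 : (b <= N1 - i)%N by rewrite /b; lia.
  have b2 : (b <= j - 1)%N by rewrite /b; lia.
  move: a b a1 a2 b1 b2 => a b a1 a2 b1 b2.
  apply: aligned_geodesic_seq => k kn.
  + by apply: Xu; move: ij; rewrite /in_u; lia.
  + apply: aligned_sym.
    have := du (i - a + k.+1)%N (j + a - k.+1)%N.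
    have -> : (i - a + k.+1).-1 = (i - a + k)%N by lia.
    have -> : (j + a - k.+1).-1 = (j + a - k.+2)%N by lia.
    have -> : (i - a + k.+1).+1 = (i - a + k.+2)%N by lia.
    have -> : (j + a - k.+1).+1 = (j + a - k)%N by lia.
    by apply; move: ij; rewrite /in_u /in_D3 /in_1 /in_2; lia.
  + by apply: un; move: ij; rewrite /in_u; lia.
Qed.

(** With y1 and y2 the shifted signals, all the distances vanish and every
    [Dpt] and [Dptsym] term contains 0 by alignment. *)
Lemma PTTGV_locally_geodesic (alpha0 alpha1 : R) u : 0 <= alpha0 -> 0 <= alpha1 ->
  signal_in M (in_u N1 N2) u -> locally_geodesic_signal M N1 N2 u ->
  PTTGV M p N1 N2 alpha0 alpha1 u = [set 0].
Proof.
move=> a0 a1 Xu lg; have [ru cu du] := locally_geodesic_aligned Xu lg.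
apply: minimum_set1; split; last first.
  by move=> r [y1 [y2 [_ _ /PTTGV_cost_ge0]]]; exact.
exists (fun i j => u i.+1 j), (fun i j => u i j.+1); split.
- by move=> i j ij; apply: Xu; move: ij; rewrite /in_1 /in_u; lia.
- by move=> i j ij; apply: Xu; move: ij; rewrite /in_2 /in_u; lia.
exists (fun _ _ => 0), (fun _ _ => 0), (fun _ _ => 0); split.
  move=> i j; rewrite /guard_set; split; case: ifP => // ij.
  - have -> : u i.-1.+1 j = u i j.
      by congr u; move: ij; rewrite /in_D1 /in_1; lia.
    exact/aligned_Dpt/ru.
  - have -> : u i j.-1.+1 = u i j.
      by congr u; move: ij; rewrite /in_D2 /in_2; lia.
    exact/aligned_Dpt/cu.
  - apply: aligned_Dptsym; [apply: ru|apply: cu|exact: du];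
      by move: ij; rewrite /in_D1 /in_D2 /in_D3 /in_1 /in_2; lia.
rewrite sum3_0// mulr0 addr0.
rewrite (@eq_sum2 _ _ _ _ _ _ (fun _ _ => 0) (fun _ _ => 0)) ?sum2_0 ?mulr0//.
move=> i j ij; rewrite /guard; split; case: ifP => // ij'; rewrite rdistxx//.
  by apply: Xu; move: ij'; rewrite /in_1 /in_u; lia.
by apply: Xu; move: ij'; rewrite /in_2 /in_u; lia.
Qed.

(** Both weights are positive, so at a minimizer every term vanishes. The
    distances identify y1 and y2 with the shifted signals; then the [Dpt] terms
    give alignment of rows and columns, and with it the [Dptsym] terms give
    alignment of antidiagonals. *)
Lemma PTTGV0_geodesic (alpha0 alpha1 : R) u : 0 < alpha0 -> 0 < alpha1 ->
  signal_in M (in_u N1 N2) u -> near_unique_geodesics M N1 N2 u ->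
  PTTGV M p N1 N2 alpha0 alpha1 u = [set 0] -> geodesic_signal M N1 N2 u.
Proof.
move=> a0 a1 Xu un E.
have [[y1 [y2 [Xy1 Xy2 [B1 [B2 [B3 [HB cost0]]]]]]] _] :
  PTTGV M p N1 N2 alpha0 alpha1 u 0 by rewrite E.
move: cost0 => /esym/eqP.
rewrite paddr_eq0 ?mulr_ge0 ?sum2_ge0 ?sum3_ge0 ?ltW//.
rewrite !mulf_eq0 (gt_eqF a0) (gt_eqF a1)/=.
move=> /andP[/eqP /sum2_eq0 A0 /eqP /sum3_eq0 B0].
have y1E i j : in_1 N1 N2 i j -> y1 i j = u i.+1 j.
  move=> ij; have [] := A0 i j; first by move: ij; rewrite /in_1 /in_u; lia.
  rewrite /guard ij => d0 _; apply/esym/(rdist_eq0 _ _ d0); last exact: Xy1.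
  by apply: Xu; move: ij; rewrite /in_1 /in_u; lia.
have y2E i j : in_2 N1 N2 i j -> y2 i j = u i j.+1.
  move=> ij; have [] := A0 i j; first by move: ij; rewrite /in_2 /in_u; lia.
  rewrite /guard ij => _ d0; apply/esym/(rdist_eq0 _ _ d0); last exact: Xy2.
  by apply: Xu; move: ij; rewrite /in_2 /in_u; lia.
have ru : row_aligned u.
  move=> i j ij; apply: Dpt0_aligned.
    by apply: un; move: ij; rewrite /in_D1 /in_1 /in_u; lia.
  have [b1 _ _] := HB i j; move: b1; rewrite /guard_set ij.
  have ijN : in_u N1 N2 i j by move: ij; rewrite /in_D1 /in_1 /in_u; lia.
  have [-> _ _] := B0 i j ijN.
  have /andP[ij1 ij2] := ij; rewrite !y1E//.
  by have -> : i.-1.+1 = i by move: ij; rewrite /in_D1 /in_1; lia.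
have cu : column_aligned u.
  move=> i j ij; apply: Dpt0_aligned.
    by apply: un; move: ij; rewrite /in_D2 /in_2 /in_u; lia.
  have [_ b2 _] := HB i j; move: b2; rewrite /guard_set ij.
  have ijN : in_u N1 N2 i j by move: ij; rewrite /in_D2 /in_2 /in_u; lia.
  have [_ -> _] := B0 i j ijN.
  have /andP[ij1 ij2] := ij; rewrite !y2E//.
  by have -> : j.-1.+1 = j by move: ij; rewrite /in_D2 /in_2; lia.
apply: aligned_geodesic_signal => //.
move=> i j ij; have [_ _ b3] := HB i j; move: b3; rewrite /guard_set ij.
have ijN : in_u N1 N2 i j by move: ij; rewrite /in_D3 /in_1 /in_2 /in_u; lia.
have [_ _ ->] := B0 i j ijN.
have /and4P[ij1 ij2 ij3 ij4] := ij; rewrite !y1E// !y2E//.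
have [i1 iN j1 jN] : [/\ 1 < i, i < N1, 1 < j & j < N2]%N.
  by split; move: ij; rewrite /in_D3 /in_1 /in_2; lia.
clear - un ru cu i1 iN j1 jN.
apply: Dptsym0_aligned; [apply: ru|apply: cu|apply: un..];
  by rewrite /in_D1 /in_D2 /in_1 /in_2 /in_u; lia.
Qed.

End Functional.

(** * Euclidean space *)

Section Euclidean.
Variables (R : realType) (K : nat) (M : complete_manifold R K).
Hypothesis HE : euclidean M.
Local Notation vec := 'rV[R]_K.
Local Notation X := (carrier M).
Local Notation signal := (nat -> nat -> vec).

Lemma euclidean_carrier (x : vec) : X x.
Proof. by case: HE => ->. Qed.
Local Hint Resolve euclidean_carrier : core.

Lemma euclidean_tangent (x v : vec) : tangent X x v.
Proof.
exists (fun t : R => x + t *: v); split.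
- by near=> t.
- by rewrite scale0r addr0.
- exact: is_derive_line.
Unshelve. all: by end_near. Qed.
Local Hint Resolve euclidean_tangent : core.

Lemma euclidean_tnorm (x v : vec) : tnorm M x v = enorm v.
Proof. by rewrite /tnorm HE.2. Qed.

(** The trilinear form T(v, w, z) = dotp (C v w) z is symmetric in its first two
    arguments and antisymmetric in the last two: six exchanges return to
    - T(v, w, z). *)
Lemma euclidean_conn0 (x v w : vec) : conn M x v w = 0.
Proof.
case: (conn_levi_civita M) => _ tf mc.
pose T (a b c : vec) : R := metric M x (conn M x a b) c.
have gC (a b : vec) : metric M x a b = metric M x b a by apply: metricC.
have Tsym a b c : T a b c = T b a c by rewrite /T (tf x a b).
have Talt a b c : T a b c = - T a c b.
  pose l (t : R) : vec := x + t *: a.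
  have dl t : is_derive t (1 : R) l a := is_derive_line x a t.
  have lX : curve_in X l by move=> t; split=> //; case: (dl t).
  have fc d : field_along X l (fun=> d) by move=> t; split=> //; exact: derivable_cst.
  have := mc l (fun=> b) (fun=> c) 0 lX (fc b) (fc c).
  rewrite /covd !derive1_cst !add0r (derive1_val (dl 0)).
  have -> : l 0 = x by rewrite /l scale0r addr0.
  have -> : (fun s => metric M (l s) b c) = cst (dotp b c).
    by apply/funext => s; rewrite HE.2.
  move=> [_]; rewrite derive_cst => /esym/eqP; rewrite addr_eq0 => /eqP.
  by rewrite /T => ->; rewrite (gC b).
suff T0 a b c : T a b c = 0 by apply: (@metric_eq0 _ _ M x) => //; exact: T0.
have : T a b c = - T a b c.
  by rewrite {1}Talt Tsym Talt opprK Tsym Talt Tsym.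
by lra.
Qed.

Lemma line_geodesic (x v : vec) : geodesic M (fun t : R => x + t *: v) /\
  derive1 (fun t : R => x + t *: v) = fun=> v.
Proof.
have E : derive1 (fun t : R => x + t *: v) = fun=> v.
  by apply/funext => t; apply: derive1_val; exact: is_derive_line.
split=> //; split=> t.
  by split=> //; case: (is_derive_line x v t).
rewrite E; split; first exact: derivable_cst.
by rewrite /covd derive1_cst euclidean_conn0 addr0.
Qed.

(** Lines are geodesics, and a geodesic is determined by its initial data. *)
Lemma euclidean_geodesic (c : R -> vec) : geodesic M c ->
  c = fun t => c 0 + t *: derive1 c 0.
Proof.
move=> gc; apply/funext; have [gl dl] := line_geodesic (c 0) (derive1 c 0).
apply: (geodesic_unique gc gl (t0 := 0)); first by rewrite scale0r addr0.
by rewrite dl.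
Qed.

Lemma euclidean_velocity (c : R -> vec) : geodesic M c ->
  derive1 c 0 = c 1 - c 0.
Proof.
move=> gc; rewrite [in c 1](euclidean_geodesic gc) scale1r.
by rewrite addrAC subrr add0r.
Qed.

(** Evaluated on a minimizing geodesic, which exists by completeness. *)
Lemma euclidean_rdist (x y : vec) : rdist M x y = enorm (y - x).
Proof.
have [c /min_geodesicP[gc c0 c1 <-]] :=
  min_geodesic_exists (euclidean_carrier x) (euclidean_carrier y).
by rewrite euclidean_tnorm euclidean_velocity// c0 c1.
Qed.

Lemma euclidean_min_geodesic (x y : vec) :
  min_geodesic M (fun t => x + t *: (y - x)) x y.
Proof.
have [gl dl] := line_geodesic x (y - x); apply/min_geodesicP; split=> //.
- by rewrite scale0r addr0.
- by rewrite scale1r addrC subrK.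
- by rewrite dl euclidean_tnorm euclidean_rdist.
Qed.

Lemma euclidean_logm (x y z : vec) : logm M x y z <-> z = y - x.
Proof.
split=> [[c [/min_geodesicP[gc c0 c1 _] <-]]|->].
  by rewrite euclidean_velocity// c0 c1.
exists (fun t => x + t *: (y - x)); split; first exact: euclidean_min_geodesic.
by have [_ ->] := line_geodesic x (y - x).
Qed.

Lemma euclidean_expm (x z y : vec) : expm M x z y <-> y = x + z.
Proof.
split=> [[c [gc c0 c1 ->]]|->].
  by rewrite (euclidean_geodesic gc) c0 c1 scale1r.
have [gl dl] := line_geodesic x z; exists (fun t => x + t *: z); split=> //.
- by rewrite scale0r addr0.
- by rewrite dl.
- by rewrite scale1r.
Qed.

Lemma euclidean_ptm (x y w z : vec) : ptm M x y w z <-> z = w.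
Proof.
split=> [[c [V [mc [fV dV] <- ->]]]|->].
  apply: derive0_constant => t; have := dV t.
  rewrite /covd euclidean_conn0 addr0 => <-.
  by apply: is_derive_derive1; case: (fV t).
exists (fun t => x + t *: (y - x)), (fun=> w); split=> //.
  exact: euclidean_min_geodesic.
split=> t; first by split=> //; exact: derivable_cst.
by rewrite /covd derive1_cst euclidean_conn0 addr0.
Qed.

Lemma minimum_singleton (S : set R) (a : R) :
  (forall r, S r <-> r = a) -> minimum S = [set a].
Proof.
move=> Sa; apply: minimum_set1; split; first exact/Sa.
by move=> r /Sa ->.
Qed.

Lemma euclidean_Dpt (x y u v : vec) :
  Dpt M x y u v = [set enorm ((y - x) - (v - u))].
Proof.
apply: minimum_singleton => r; split=> [[z1 [z2 [w]]]|->].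
  move=> [/euclidean_logm -> /euclidean_logm -> /euclidean_ptm -> ->].
  by rewrite euclidean_tnorm.
exists (y - x), (v - u), (v - u); split; last by rewrite euclidean_tnorm.
- exact/euclidean_logm.
- exact/euclidean_logm.
- exact/euclidean_ptm.
Qed.

Lemma euclidean_Dptsym (a b a' b' e f g h : vec) :
  Dptsym M a b a' b' e f g h =
  [set enorm ((h - g) - (b - a) + ((f - e) - (b' - a')))].
Proof.
have E : (h - g) - (b - a) + ((f - e) - (b' - a')) =
    h - (g + (b - a)) - (e + (b' - a') - f).
  by apply/rowP => k; rewrite !mxE; ring.
have T (x y s t : vec) : exists w z, [/\ logm M s t w, ptm M s x w z
    & expm M x z (x + (t - s))].
  exists (t - s), (t - s); split; first exact/euclidean_logm.
    exact/euclidean_ptm.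
  exact/euclidean_expm.
apply: minimum_singleton => r; split=> [[r1 [r2 []]]|->].
  move=> [w1 [z1 [/euclidean_logm -> /euclidean_ptm -> /euclidean_expm ->]]].
  move=> [w2 [z2 [/euclidean_logm -> /euclidean_ptm -> /euclidean_expm ->]]].
  by rewrite euclidean_Dpt => ->; rewrite E.
exists (g + (b - a)), (e + (b' - a')); split; [exact: T|exact: T|].
by rewrite euclidean_Dpt E.
Qed.

Lemma enormN (v : vec) : enorm (- v) = enorm v.
Proof. by rewrite /enorm /dotp linearN/= mulmxN mulNmx opprK. Qed.

Lemma enormBC (v w : vec) : enorm (v - w) = enorm (w - v).
Proof. by rewrite -enormN opprB. Qed.

Variables (p : R) (N1 N2 : nat).

Lemma euclidean_PTTGV_cost (alpha0 alpha1 : R) (u y1 y2 : signal) :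
  PTTGV_cost M p N1 N2 alpha0 alpha1 u y1 y2 =
  [set TGV_cost p N1 N2 alpha0 alpha1 u
    (fun i j => y1 i j - u i j) (fun i j => y2 i j - u i j)].
Proof.
set w1 := (X in TGV_cost _ _ _ _ _ _ X); set w2 := (X in TGV_cost _ _ _ _ _ _ _ X).
pose D1 i j := guard (in_D1 N1 N2 i j) (enorm (w1 i.-1 j - w1 i j)).
pose D2 i j := guard (in_D2 N1 N2 i j) (enorm (w2 i j.-1 - w2 i j)).
pose D3 i j := guard (in_D3 N1 N2 i j)
  (enorm ((w1 i j.-1 - w1 i j) + (w2 i.-1 j - w2 i j))).
have C1 : PTTGV_cost M p N1 N2 alpha0 alpha1 u y1 y2
    (TGV_cost p N1 N2 alpha0 alpha1 u w1 w2).
  exists D1, D2, D3; split.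
    move=> i j; rewrite /guard_set /D1 /D2 /D3 /guard; split; case: ifP => // ij.
    - by rewrite euclidean_Dpt enormBC.
    - by rewrite euclidean_Dpt enormBC.
    - rewrite euclidean_Dptsym; congr enorm; rewrite /w1 /w2.
      by apply/rowP => k; rewrite !mxE; ring.
  refine (congr1 (fun s => alpha1 * s + _) _); apply: eq_sum2 => i j _.
  rewrite !euclidean_rdist; split; congr guard; rewrite enormBC; congr enorm.
    by rewrite /w1 opprB addrA subrK.
  by rewrite /w2 opprB addrA subrK.
by apply/seteqP; split=> r => [Cr|->//]; exact: PTTGV_cost_unique Cr C1.
Qed.

Lemma euclidean_PTTGV (alpha0 alpha1 : R) (u : signal) :
  PTTGV M p N1 N2 alpha0 alpha1 u = TGV p N1 N2 alpha0 alpha1 u.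
Proof.
congr minimum; apply/seteqP; split=> r.
  move=> [y1 [y2 [_ _]]]; rewrite euclidean_PTTGV_cost => ->.
  by exists (fun i j => y1 i j - u i j), (fun i j => y2 i j - u i j).
move=> [w1 [w2 ->]].
exists (fun i j => u i j + w1 i j), (fun i j => u i j + w2 i j); split.
  - by move=> i j _; exact: euclidean_carrier.
  - by move=> i j _; exact: euclidean_carrier.
have E (w : signal) : (fun i j => u i j + w i j - u i j) = w.
  by apply/funext => i; apply/funext => j; rewrite addrAC subrr add0r.
by rewrite euclidean_PTTGV_cost (E w1) (E w2).
Qed.

Lemma euclidean_shift_cost (u : signal) :
  TGV_cost p N1 N2 1 0 u (fun i j => u i.+1 j - u i j) (fun i j => u i j.+1 - u i j)
  = TV2_euclidean p N1 N2 u.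
Proof.
rewrite /TGV_cost mul0r mul1r add0r /TV2_euclidean; apply: eq_sum3 => i j ij.
split.
- have -> : [&& in_u N1 N2 i.+1 j, in_u N1 N2 i j & in_u N1 N2 i.-1 j] =
      in_D1 N1 N2 i j by move: ij; rewrite /in_D1 /in_1 /in_u; lia.
  rewrite /guard; case: ifP => // ijD.
  have -> : i.-1.+1 = i by move: ijD; rewrite /in_D1 /in_1; lia.
  by rewrite enormBC; congr enorm; apply/rowP => k; rewrite !mxE; ring.
- have -> : [&& in_u N1 N2 i j.+1, in_u N1 N2 i j & in_u N1 N2 i j.-1] =
      in_D2 N1 N2 i j by move: ij; rewrite /in_D2 /in_2 /in_u; lia.
  rewrite /guard; case: ifP => // ijD.
  have -> : j.-1.+1 = j by move: ijD; rewrite /in_D2 /in_2; lia.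
  by rewrite enormBC; congr enorm; apply/rowP => k; rewrite !mxE; ring.
- have -> : [&& in_u N1 N2 i.+1 j, in_u N1 N2 i j, in_u N1 N2 i.+1 j.-1,
           in_u N1 N2 i j.-1, in_u N1 N2 i j.+1, in_u N1 N2 i.-1 j.+1
         & in_u N1 N2 i.-1 j] =
      in_D3 N1 N2 i j by move: ij; rewrite /in_D3 /in_1 /in_2 /in_u; lia.
  rewrite /guard; case: ifP => // ijD.
  by rewrite -enormN; congr enorm; apply/rowP => k; rewrite !mxE; ring.
Qed.

End Euclidean.

(** * Continuity of powers *)

Section PowerContinuity.
Variable R : realType.

(** The absolute value is taken because [powR] jumps to the value 1 on negative
    reals. *)
Lemma powR_norm_continuous (p : R) : 0 < p -> continuous (fun a : R => `|a| `^ p).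
Proof.
move=> p0 a; have [->|a0] := eqVneq a 0.
  rewrite /continuous_at normr0 powR0 ?gt_eqF//.
  apply/cvgrPdist_lt => e e0; near=> b.
  rewrite sub0r normrN ger0_norm ?powR_ge0//.
  have -> : e = (e `^ p^-1) `^ p.
    by rewrite -powRrM mulVf ?gt_eqF// powRr1// ltW.
  apply: gt0_ltr_powR => //; rewrite ?nnegrE ?powR_ge0//.
  near: b; apply: (@nbhs0_lt R R); exact: powR_gt0.
have a0' : 0 < `|a| by rewrite normr_gt0.
have -> : (fun b : R => `|b| `^ p) = (fun b : R => b `^ p) \o (fun b : R => `|b|).
  by [].
apply: continuous_comp; first exact: norm_continuous.
apply: differentiable_continuous; apply/derivable1_diffP.
by apply: derivable_powR; rewrite in_itv/= andbT.
Unshelve. all: by end_near. Qed.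

Lemma powR_continuous_comp (T : topologicalType) (f : T -> R) (p : R) : 0 < p ->
  (forall x, 0 <= f x) -> continuous f -> continuous (fun x => f x `^ p).
Proof.
move=> p0 f0 cf x.
have -> : (fun x => f x `^ p) = (fun a => `|a| `^ p) \o f.
  by apply/funext => y /=; rewrite ger0_norm.
by apply: continuous_comp; [exact: cf|exact: powR_norm_continuous].
Qed.

End PowerContinuity.

(** * Existence of a minimizer in Euclidean space *)

Section Existence.
Variables (R : realType) (K : nat) (p : R) (N1 N2 : nat) (alpha0 alpha1 : R).
Hypotheses (p_ge1 : 1 <= p) (a0 : 0 <= alpha0) (a1 : 0 < alpha1).
Local Notation vec := 'rV[R]_K.
Local Notation signal := (nat -> nat -> vec).
Implicit Types u w : signal.

Let p_gt0 : 0 < p.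
Proof. exact: lt_le_trans ltr01 p_ge1. Qed.

Lemma entry_le_enorm (v : vec) k : `|v 0 k| <= enorm v.
Proof.
rewrite /enorm -sqrtr_sqr; apply: ler_wsqrtr.
rewrite /dotp mxE (bigD1 k)//= mxE expr2 lerDl.
by apply: sumr_ge0 => j _; rewrite mxE -expr2 sqr_ge0.
Qed.

Lemma powR_root_ge_l (a b : R) : 0 <= a -> a <= (a `^ p + b `^ p) `^ p^-1.
Proof.
move=> a_ge0; rewrite -{1}(powRr1 a_ge0) -(@mulfV _ p) ?gt_eqF// powRrM.
apply: ge0_ler_powR; rewrite ?invr_ge0 ?(ltW p_gt0)// ?nnegrE ?addr_ge0 ?powR_ge0//.
by rewrite lerDl powR_ge0.
Qed.

Lemma powR_root_ge_r (a b : R) : 0 <= b -> b <= (a `^ p + b `^ p) `^ p^-1.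
Proof. by move=> b_ge0; rewrite addrC powR_root_ge_l. Qed.

Section Continuity.
Variable T : topologicalType.

Lemma continuous_sum_seq (I : Type) (s : seq I) (F : I -> T -> R) :
  (forall i, continuous (F i)) -> continuous (fun x => \sum_(i <- s) F i x).
Proof.
move=> cF; elim: s => [|i s IH] x.
  by under eq_fun do rewrite big_nil; exact: cst_continuous.
under eq_fun do rewrite big_cons.
by apply: cvgD; [exact: cF|exact: IH].
Qed.

Lemma continuous_grid_sum (F : nat -> nat -> T -> R) :
  (forall i j, continuous (F i j)) ->
  continuous (fun x => grid_sum N1 N2 (fun i j => F i j x)).
Proof. by move=> cF; apply: continuous_sum_seq => i; exact: continuous_sum_seq. Qed.

Lemma continuous_sum2 (A1 A2 : nat -> nat -> T -> R) :
  (forall i j x, 0 <= A1 i j x) -> (forall i j x, 0 <= A2 i j x) ->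
  (forall i j, continuous (A1 i j)) -> (forall i j, continuous (A2 i j)) ->
  continuous (fun x => sum2 p N1 N2 (fun i j => A1 i j x) (fun i j => A2 i j x)).
Proof.
move=> A10 A20 c1 c2; apply: continuous_grid_sum => i j.
apply: powR_continuous_comp; rewrite ?invr_gt0//.
  by move=> x; rewrite addr_ge0 ?powR_ge0.
by move=> x; apply: cvgD; apply: powR_continuous_comp.
Qed.

Lemma continuous_sum3 (B1 B2 B3 : nat -> nat -> T -> R) :
  (forall i j x, 0 <= B1 i j x) -> (forall i j x, 0 <= B2 i j x) ->
  (forall i j x, 0 <= B3 i j x) ->
  (forall i j, continuous (B1 i j)) -> (forall i j, continuous (B2 i j)) ->
  (forall i j, continuous (B3 i j)) ->
  continuous (fun x => sum3 p N1 N2 (fun i j => B1 i j x) (fun i j => B2 i j x)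
    (fun i j => B3 i j x)).
Proof.
move=> B10 B20 B30 c1 c2 c3; apply: continuous_grid_sum => i j.
apply: powR_continuous_comp; rewrite ?invr_gt0//.
  by move=> x; rewrite !addr_ge0 ?mulr_ge0 ?powR_ge0.
move=> x; apply: cvgD; first by apply: cvgD; apply: powR_continuous_comp.
by apply: cvgM; [exact: cvg_cst|apply: powR_continuous_comp].
Qed.

Lemma continuous_enorm (f : T -> vec) :
  (forall k, continuous (fun x => f x 0 k)) -> continuous (fun x => enorm (f x)).
Proof.
move=> cf x.
have cd : continuous (fun x => dotp (f x) (f x)).
  have -> : (fun x => dotp (f x) (f x)) = (fun x => \sum_k f x 0 k * f x 0 k).
    apply/funext => y; rewrite /dotp mxE; apply: eq_bigr => k _.
    by rewrite mxE.
  by apply: continuous_sum_seq => k y; apply: cvgM; exact: cf.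
have -> : (fun x => enorm (f x)) = Num.sqrt \o (fun x => dotp (f x) (f x)) by [].
by apply: continuous_comp; [exact: cd|exact: sqrt_continuous].
Qed.

Lemma continuous_guard b (f : T -> R) :
  continuous f -> continuous (fun x => guard b (f x)).
Proof. by case: b => // _ x; exact: cst_continuous. Qed.

Lemma continuous_TGV_cost u (w1 w2 : T -> signal) :
  (forall i j k, continuous (fun x => w1 x i j 0 k)) ->
  (forall i j k, continuous (fun x => w2 x i j 0 k)) ->
  continuous (fun x => TGV_cost p N1 N2 alpha0 alpha1 u (w1 x) (w2 x)).
Proof.
move=> c1 c2.
have g0 b (v : vec) : 0 <= guard b (enorm v).
  by case: b => /=; [exact: sqrtr_ge0|exact: lexx].
have cD (f h : T -> vec) : (forall k, continuous (fun x => f x 0 k)) ->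
    (forall k, continuous (fun x => h x 0 k)) ->
    forall k, continuous (fun x => (f x + h x) 0 k).
  move=> cf ch k x; under eq_fun do rewrite mxE.
  by apply: cvgD; [exact: cf|exact: ch].
have cN (f : T -> vec) : (forall k, continuous (fun x => f x 0 k)) ->
    forall k, continuous (fun x => (- f x) 0 k).
  by move=> cf k x; under eq_fun do rewrite mxE; apply: cvgN; exact: cf.
have cC (v : vec) : forall k, continuous (fun _ : T => v 0 k).
  by move=> k x; exact: cst_continuous.
have C2 := @continuous_sum2
  (fun i j x => guard (in_1 N1 N2 i j) (enorm (u i.+1 j - u i j - w1 x i j)))
  (fun i j x => guard (in_2 N1 N2 i j) (enorm (u i j.+1 - u i j - w2 x i j)))
  (fun i j x => g0 _ _) (fun i j x => g0 _ _)
  (fun i j => continuous_guard (continuous_enorm (cD _ _ (cC _) (cN _ (c1 i j)))))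
  (fun i j => continuous_guard (continuous_enorm (cD _ _ (cC _) (cN _ (c2 i j))))).
have C3 := @continuous_sum3
  (fun i j x => guard (in_D1 N1 N2 i j) (enorm (w1 x i.-1 j - w1 x i j)))
  (fun i j x => guard (in_D2 N1 N2 i j) (enorm (w2 x i j.-1 - w2 x i j)))
  (fun i j x => guard (in_D3 N1 N2 i j)
    (enorm ((w1 x i j.-1 - w1 x i j) + (w2 x i.-1 j - w2 x i j))))
  (fun i j x => g0 _ _) (fun i j x => g0 _ _) (fun i j x => g0 _ _)
  (fun i j => continuous_guard (continuous_enorm
    (cD _ _ (c1 i.-1 j) (cN _ (c1 i j)))))
  (fun i j => continuous_guard (continuous_enorm
    (cD _ _ (c2 i j.-1) (cN _ (c2 i j)))))
  (fun i j => continuous_guard (continuous_enorm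
    (cD _ _ (cD _ _ (c1 i j.-1) (cN _ (c1 i j)))
      (cD _ _ (c2 i.-1 j) (cN _ (c2 i j)))))).
by move=> x; exact: cvgD (cvgM (cvg_cst alpha1) (C2 x)) (cvgM (cvg_cst alpha0) (C3 x)).
Qed.

End Continuity.

Lemma eq_TGV_cost u (w1 w2 w1' w2' : signal) :
  (forall i j, in_1 N1 N2 i j -> w1 i j = w1' i j) ->
  (forall i j, in_2 N1 N2 i j -> w2 i j = w2' i j) ->
  TGV_cost p N1 N2 alpha0 alpha1 u w1 w2 = TGV_cost p N1 N2 alpha0 alpha1 u w1' w2'.
Proof.
move=> E1 E2; refine (f_equal2 (fun s t => alpha1 * s + alpha0 * t) _ _);
  [apply: eq_sum2 => i j _|apply: eq_sum3 => i j _].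
  by rewrite /guard; split; case: ifP => // ij; rewrite (E1, E2).
rewrite /guard; split; case: ifP => //.
- by move=> /andP[ij1 ij2]; rewrite !E1.
- by move=> /andP[ij1 ij2]; rewrite !E2.
- by move=> /and4P[ij1 ij2 ij3 ij4]; rewrite !E1// !E2.
Qed.

(** The data term alone bounds the distance of each in-range entry of w1 and w2
    to the discrete gradient of u. *)
Lemma TGV_cost_coercive u (w1 w2 : signal) i j k :
  (in_1 N1 N2 i j -> alpha1 * `|(w1 i j - (u i.+1 j - u i j)) 0 k| <=
     TGV_cost p N1 N2 alpha0 alpha1 u w1 w2) /\
  (in_2 N1 N2 i j -> alpha1 * `|(w2 i j - (u i j.+1 - u i j)) 0 k| <=
     TGV_cost p N1 N2 alpha0 alpha1 u w1 w2).
Proof.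
have H a : a <= sum2 p N1 N2
    (fun i j => guard (in_1 N1 N2 i j) (enorm (u i.+1 j - u i j - w1 i j)))
    (fun i j => guard (in_2 N1 N2 i j) (enorm (u i j.+1 - u i j - w2 i j))) ->
    alpha1 * a <= TGV_cost p N1 N2 alpha0 alpha1 u w1 w2.
  move=> aS; rewrite /TGV_cost (le_trans (ler_wpM2l (ltW a1) aS))// lerDl.
  by rewrite mulr_ge0 ?sum3_ge0.
split=> ij; apply: H.
  apply: le_trans (@grid_sum_ge_term R N1 N2 _ i j _ _).
  - have -> : (w1 i j - (u i.+1 j - u i j)) 0 k =
        - (u i.+1 j - u i j - w1 i j) 0 k by rewrite !mxE; ring.
    rewrite normrN ij /=; apply: le_trans (entry_le_enorm _ k) _.
    by apply: powR_root_ge_l; exact: sqrtr_ge0.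
  - by move=> *; exact: powR_ge0.
  - by move: ij; rewrite /in_1 /in_u; lia.
apply: le_trans (@grid_sum_ge_term R N1 N2 _ i j _ _).
- have -> : (w2 i j - (u i j.+1 - u i j)) 0 k =
      - (u i j.+1 - u i j - w2 i j) 0 k by rewrite !mxE; ring.
  rewrite normrN ij /=; apply: le_trans (entry_le_enorm _ k) _.
  by apply: powR_root_ge_r; exact: sqrtr_ge0.
- by move=> *; exact: powR_ge0.
- by move: ij; rewrite /in_2 /in_u; lia.
Qed.

(** The cost of the discrete gradient, [m0], is at most that of any pair of fields
    with an entry farther than m0 / alpha1 from the gradient. It thus suffices to
    minimize over a product of compact intervals, where the continuous cost
    attains its minimum by Tychonoff's theorem. *)
Theorem TGV_attained u : exists m, TGV p N1 N2 alpha0 alpha1 u = [set m].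
Proof.
pose I : eqType := (bool * nat * nat * 'I_K)%type.
pose T := prod_topology (fun _ : I => R).
pose grad (b : bool) i j : vec :=
  if b then u i.+1 j - u i j else u i j.+1 - u i j.
pose m0 := TGV_cost p N1 N2 alpha0 alpha1 u (grad true) (grad false).
pose r := m0 / alpha1.
have r0 : 0 <= r.
  apply: divr_ge0; last exact: ltW.
  by apply: addr_ge0; apply: mulr_ge0; rewrite ?sum2_ge0 ?sum3_ge0// ltW.
pose sig (f : T) (b : bool) : signal := fun i j => \row_k f (b, i, j, k).
pose F (f : T) := TGV_cost p N1 N2 alpha0 alpha1 u (sig f true) (sig f false).
pose box (x : I) : set R :=
  let: (b, i, j, k) := x in `[grad b i j 0 k - r, grad b i j 0 k + r]%classic.
pose A : set T := [set f | forall x, box x (f x)].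
have cA : compact A.
  by apply: tychonoff => -[[[b i] j] k]; exact: segment_compact.
pose g0 : T := fun x => let: (b, i, j, k) := x in grad b i j 0 k.
have Ag0 : A g0.
  by move=> [[[b i] j] k] /=; rewrite in_itv/= gerBl lerDl r0.
have cF : continuous F.
  have cs b i j k : continuous (fun f : T => sig f b i j 0 k).
    have -> : (fun f : T => sig f b i j 0 k) = proj (b, i, j, k).
      by apply/funext => f; rewrite mxE.
    exact: proj_continuous.
  by apply: continuous_TGV_cost => i j k; exact: cs.
have [f] := compact_EVT_min (ex_intro _ _ Ag0) cA (continuous_subspaceT cF).
rewrite inE => Af Fmin; exists (F f); apply: minimum_set1; split.
  by exists (sig f true), (sig f false).
move=> _ [w1 [w2 ->]].
have Fg0 : F f <= m0.
  have -> : m0 = F g0.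
    have sg b : sig g0 b = grad b.
      by apply/funext => i; apply/funext => j; apply/rowP => k; rewrite mxE.
    by rewrite /F (sg true) (sg false).
  by apply: Fmin; rewrite inE.
have [m0le|small] : m0 <= TGV_cost p N1 N2 alpha0 alpha1 u w1 w2 \/
    TGV_cost p N1 N2 alpha0 alpha1 u w1 w2 <= m0 by apply/orP; exact: le_total.
  exact: le_trans Fg0 m0le.
pose rng (b : bool) := if b then in_1 N1 N2 else in_2 N1 N2.
pose w (b : bool) := if b then w1 else w2.
(* Out-of-range entries do not affect the cost: they are moved into the box. *)
pose h : T := fun x => let: (b, i, j, k) := x in
  if rng b i j then w b i j 0 k else grad b i j 0 k.
have Ah : A h.
  move=> [[[b i] j] k] /=; case: ifP => ij; last by rewrite in_itv/= gerBl lerDl r0.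
  suff : `|w b i j 0 k - grad b i j 0 k| <= r by rewrite ler_distl in_itv.
  rewrite /r ler_pdivlMr// mulrC.
  have subE (v v' : vec) : v 0 k - v' 0 k = (v - v') 0 k by rewrite !mxE.
  rewrite subE; have [C1 C2] := TGV_cost_coercive u w1 w2 i j k.
  by case: b ij => ij; [exact: le_trans (C1 ij) small|exact: le_trans (C2 ij) small].
have -> : TGV_cost p N1 N2 alpha0 alpha1 u w1 w2 = F h.
  by apply: eq_TGV_cost => i j ij; apply/rowP => k; rewrite mxE /= ij.
by apply: Fmin; rewrite inE.
Qed.

End Existence.

(** * The gradient field and second-order total variation *)

Section TotalVariation.
Variables (R : realType) (K : nat) (M : complete_manifold R K).
Variables (p : R) (N1 N2 : nat).
Hypothesis p_ge1 : 1 <= p.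
Local Notation signal := (nat -> nat -> 'rV[R]_K).

Definition gradient_cost (alpha0 alpha1 : R) (u : signal) : set R :=
  PTTGV_cost M p N1 N2 alpha0 alpha1 u (fun i j => u i.+1 j) (fun i j => u i j.+1).

(** The cost of the gradient field is a set with at most one element; with weight
    0 on the distances and 1 on the other terms, its element is the desired
    second-order total variation. When the set is empty (a term of the cost is
    not attained), [get] returns a default value. *)
Definition TV2 (u : signal) : R := get (gradient_cost 1 0 u).

Lemma gradient_cost_local (u v : signal) :
  (forall i j, in_u N1 N2 i j -> u i j = v i j) ->
  gradient_cost 1 0 u `<=` gradient_cost 1 0 v.
Proof.
move=> uv r [B1 [B2 [B3 [HB ->]]]]; exists B1, B2, B3.
split; last first.
  refine (congr1 (fun s => s + 1 * sum3 p N1 N2 B1 B2 B3) _).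
  exact: etrans (mul0r _) (esym (mul0r _)).
move=> i j; have [b1 b2 b3] := HB i j; split.
- case E : (in_D1 N1 N2 i j) b1 => //=.
  by rewrite !uv //; move: E; rewrite /in_D1 /in_1 /in_u; lia.
- case E : (in_D2 N1 N2 i j) b2 => //=.
  by rewrite !uv //; move: E; rewrite /in_D2 /in_2 /in_u; lia.
- case E : (in_D3 N1 N2 i j) b3 => //=.
  by rewrite !uv //; move: E; rewrite /in_D3 /in_1 /in_2 /in_u; lia.
Qed.

Lemma TV2_admissible : admissible_TV2 M p N1 N2 TV2.
Proof.
split=> [u v uv|HE u].
  suff E : gradient_cost 1 0 u = gradient_cost 1 0 v by rewrite /TV2 E.
  apply/seteqP; split; first exact: gradient_cost_local uv.
  by apply: gradient_cost_local => i j /uv ->.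
rewrite /TV2 /gradient_cost (euclidean_PTTGV_cost HE) euclidean_shift_cost.
by apply: get_unique => // r ->.
Qed.

Lemma PTTGV_gradient_field (alpha0 alpha1 : R) (u : signal) :
  signal_in M (in_u N1 N2) u ->
  attained_at M p N1 N2 alpha0 alpha1 u
    (fun i j => u i.+1 j) (fun i j => u i j.+1) ->
  PTTGV M p N1 N2 alpha0 alpha1 u = [set alpha0 * TV2 u].
Proof.
move=> Xu [r [B1 [B2 [B3 [HB ->]]]] rmin]; rewrite /PTTGV (minimum_set1 rmin).
have C : gradient_cost 1 0 u (sum3 p N1 N2 B1 B2 B3).
  by exists B1, B2, B3; rewrite mul0r mul1r add0r.
have -> : TV2 u = sum3 p N1 N2 B1 B2 B3.
  by apply: get_unique => // s Cs; exact: PTTGV_cost_unique Cs C.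
rewrite (@eq_sum2 _ _ _ _ _ _ (fun _ _ => 0) (fun _ _ => 0)).
  by rewrite sum2_0 ?mulr0 ?add0r// gt_eqF// (lt_le_trans ltr01).
move=> i j ij; rewrite /guard; split; case: ifP => // ij'; rewrite rdistxx//.
  by apply: Xu; move: ij'; rewrite /in_1 /in_u; lia.
by apply: Xu; move: ij'; rewrite /in_2 /in_u; lia.
Qed.

End TotalVariation.

Theorem theorem2p19 (R : realType) (K : nat) (M : complete_manifold R K)
    (N1 N2 : nat) (alpha0 alpha1 p : R)
    (alpha0_gt0 : 0 < alpha0) (alpha1_gt0 : 0 < alpha1) (p_ge1 : 1 <= p) :
  (euclidean M ->
   forall u : nat -> nat -> 'rV[R]_K, signal_in M (in_u N1 N2) u ->
   exists m : R,
     PTTGV M p N1 N2 alpha0 alpha1 u = [set m] /\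
     TGV p N1 N2 alpha0 alpha1 u = [set m]) /\
  (forall u : nat -> nat -> 'rV[R]_K, signal_in M (in_u N1 N2) u ->
   attained_at M p N1 N2 alpha0 alpha1 u u u ->
   PTTGV M p N1 N2 alpha0 alpha1 u =
     [set alpha1 * sum2 p N1 N2
        (fun i j => guard (in_u N1 N2 i.+1 j && in_u N1 N2 i j)
           (rdist M (u i.+1 j) (u i j)))
        (fun i j => guard (in_u N1 N2 i j.+1 && in_u N1 N2 i j)
           (rdist M (u i j.+1) (u i j)))]) /\
  (exists2 TV2 : (nat -> nat -> 'rV[R]_K) -> R,
     admissible_TV2 M p N1 N2 TV2 &
     forall u : nat -> nat -> 'rV[R]_K, signal_in M (in_u N1 N2) u ->
       attained_at M p N1 N2 alpha0 alpha1 u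
         (fun i j => u i.+1 j) (fun i j => u i j.+1) ->
       PTTGV M p N1 N2 alpha0 alpha1 u = [set alpha0 * TV2 u]) /\
  (forall u : nat -> nat -> 'rV[R]_K, signal_in M (in_u N1 N2) u ->
   locally_geodesic_signal M N1 N2 u ->
   PTTGV M p N1 N2 alpha0 alpha1 u = [set 0]) /\
  (forall u : nat -> nat -> 'rV[R]_K, signal_in M (in_u N1 N2) u ->
   near_unique_geodesics M N1 N2 u ->
   PTTGV M p N1 N2 alpha0 alpha1 u = [set 0] ->
   geodesic_signal M N1 N2 u).
Proof.
split.
  move=> HE u _; have [m Em] := TGV_attained N1 N2 p_ge1
    (ltW alpha0_gt0) alpha1_gt0 u.
  by exists m; rewrite euclidean_PTTGV.
split; first by move=> u _; exact: PTTGV_zero_field.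
split.
  exists (TV2 M p N1 N2); first exact: TV2_admissible.
  by move=> u; exact: PTTGV_gradient_field.
split; first by move=> u; apply: PTTGV_locally_geodesic => //; exact: ltW.
by move=> u; exact: PTTGV0_geodesic.
Qed.
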